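(* Let $A=\mathcal{H}(\mathcal{Q}_n^{-1}[t])$ (with $n\geq 4$, $t=(\Lambda,\Gamma)$, $\Lambda,\Gamma\in\Bbbk$) or $A=\mathcal{H}(\mathcal{Q}_3^{-1}[\lambda])$ (with $n=3$, $\lambda\in\Bbbk$). Let $M$ be an $A$-module such that, as an $\mathbb{S}_n$-module, $M=M[\epsilon]\oplus M[\operatorname{sgn}]$, with $\dim M[\epsilon]=p$ and $\dim M[\operatorname{sgn}]=q$. Then: (1) $M$ is simple if and only if $M=S_\epsilon$ or $M=S_{\operatorname{sgn}}$ (up to isomorphism). (2) $M$ is indecomposable if and only if $M$ is simple or $p=q=1$. In this last case, there are two non-isomorphic indecomposable modules, namely $M_{\epsilon,\operatorname{sgn}}$ and $M_{\operatorname{sgn},\epsilon}$.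
   Context: $\Bbbk$ is an algebraically closed field of characteristic zero; $\mathbb{S}_n$ is the symmetric group and $\mathcal{O}_2^n$ its conjugacy class of transpositions; $\epsilon$ and $\operatorname{sgn}$ are the trivial and sign characters of $\mathbb{S}_n$. For $n\geq4$ and $\Lambda,\Gamma\in\Bbbk$, $\mathcal{H}(\mathcal{Q}_n^{-1}[(\Lambda,\Gamma)])$ is the pointed Hopf algebra generated as an algebra by $H_t$ ($t\in\mathbb{S}_n$) and $a_i$ ($i\in\mathcal{O}_2^n$) with relations: $H_e=1$, $H_tH_s=H_{ts}$; $H_ta_i=\operatorname{sgn}(t)\,a_{tit^{-1}}H_t$; $a_i^2=0$; $a_ia_j+a_ja_i=\Lambda(1-H_iH_j)$ if $i\neq j$ commute; $a_ia_j+a_{iji}a_i+a_ja_{iji}=\Gamma(1-H_iH_j)$ if $i,j$ do not commute. $\mathcal{H}(\mathcal{Q}_3^{-1}[\lambda])$ is defined by the same presentation for $n=3$ with $\Gamma=\lambda$ (there are no distinct commuting transpositions in $\mathbb{S}_3$). The comultiplication is given by $\Delta(H_t)=H_t\otimes H_t$ and $\Delta(a_i)=H_i\otimes a_i+a_i\otimes 1$. Any $A$-module is an $\mathbb{S}_n$-module via $t\mapsto H_t$, and $M[\rho]$ denotes its $\rho$-isotypic component. For $\rho\in\{\epsilon,\operatorname{sgn}\}$, $S_\rho$ is the one-dimensional $A$-module on which $H_t$ acts by $\rho(t)$ and all $a_i$ act by $0$. For $\{\rho,\mu\}=\{\epsilon,\operatorname{sgn}\}$, $M_{\rho,\mu}$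 is the (unique up to isomorphism) indecomposable $A$-module $N$ fitting in an exact sequence $0\to S_\mu\to N\to S_\rho\to0$.
   Formalization: In (2), ''p=q=1'' is read as ''p=q=1 and M is not isomorphic to the direct sum of S_ε and S_sgn'', since that direct sum has p=q=1 but is decomposable. *)

(* Defs.v *)
From HB Require Import structures.
From mathcomp Require Import all_boot all_order all_algebra all_fingroup.
From mathcomp Require Import monalg.
From mathcomp Require Import boolp.

Set Implicit Arguments.
Unset Strict Implicit.
Unset Printing Implicit Defensive.

Import GRing.Theory.
(* fingroup shadows repr *)
Import generic_quotient.
Local Open Scope ring_scope.
Local Open Scope quotient_scope.

(* The free associative algebra k<X>: the algebra of the free
   (noncommutative) monoid on X. Product and scaling are those of {malg _},
   locked because their unfolding makes unification intractable. *)
Section FreeAlgebra.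
Variables (k : fieldType) (X : choiceType).

Definition free_alg : Type := {malg k[{fmonom X}]}.

HB.instance Definition _ := GRing.Zmodule.on free_alg.

Local Notation F0 := {malg k[{fmonom X}]}.

Definition free_one : free_alg := (1 : F0).
Definition free_mul : free_alg -> free_alg -> free_alg :=
  locked (fun u v : F0 => u * v).
Definition free_scale : k -> free_alg -> free_alg :=
  locked (fun c (u : F0) => c *: u).

Lemma free_mulE (u v : F0) : free_mul u v = u * v.
Proof. by rewrite /free_mul -lock. Qed.

Lemma free_scaleE c (u : F0) : free_scale c u = c *: u.
Proof. by rewrite /free_scale -lock. Qed.

Lemma free_mulA : associative free_mul.
Proof. by move=> u v w; rewrite !free_mulE; apply: (@mulrA F0). Qed.
Lemma free_mul1 : left_id free_one free_mul.
Proof. by move=> u; rewrite free_mulE; apply: (@mul1r F0). Qed.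
Lemma free_mulr1 : right_id free_one free_mul.
Proof. by move=> u; rewrite free_mulE; apply: (@mulr1 F0). Qed.
Lemma free_mulDl : left_distributive free_mul +%R.
Proof. by move=> u v w; rewrite !free_mulE; apply: (@mulrDl F0). Qed.
Lemma free_mulDr : right_distributive free_mul +%R.
Proof. by move=> u v w; rewrite !free_mulE; apply: (@mulrDr F0). Qed.
Lemma free_one_neq0 : free_one != 0.
Proof. exact: (@oner_neq0 F0). Qed.

HB.instance Definition _ := GRing.Zmodule_isNzRing.Build free_alg
  free_mulA free_mul1 free_mulr1 free_mulDl free_mulDr free_one_neq0.

Lemma free_scalerA a b v :
  free_scale a (free_scale b v) = free_scale (a * b) v.
Proof. by rewrite !free_scaleE; apply: (@scalerA k F0). Qed.
Lemma free_scale1 : left_id 1 free_scale.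
Proof. by move=> v; rewrite free_scaleE; apply: (@scale1r k F0). Qed.
Lemma free_scaleDr : right_distributive free_scale +%R.
Proof. by move=> c u v; rewrite !free_scaleE; apply: (@scalerDr k F0). Qed.
Lemma free_scaleDl v : {morph free_scale^~ v : a b / a + b}.
Proof. by move=> a b; rewrite !free_scaleE; apply: (@scalerDl k F0). Qed.

HB.instance Definition _ := GRing.Zmodule_isLmodule.Build k free_alg
  free_scalerA free_scale1 free_scaleDr free_scaleDl.

Lemma free_scalerAl c (u v : free_alg) : c *: (u * v) = (c *: u) * v.
Proof.
rewrite /GRing.scale /GRing.mul /= !free_mulE !free_scaleE.
exact: (@scalerAl k F0).
Qed.

Lemma mul_gmalgC (g : F0) (c : k) : g * (c%:MP : F0) = c *: g.
Proof.
rewrite -mul_malgC !malgM_def fgmulgU fgmulUg.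
by apply: eq_bigr => m _; rewrite mulrC mulm1 mul1m.
Qed.

Lemma free_scalerAr c (u v : free_alg) : c *: (u * v) = u * (c *: v).
Proof.
rewrite /GRing.scale /GRing.mul /= !free_mulE !free_scaleE.
by rewrite -!mul_gmalgC (@mulrA F0).
Qed.

HB.instance Definition _ :=
  GRing.Lmodule_isLalgebra.Build k free_alg free_scalerAl.
HB.instance Definition _ :=
  GRing.Lalgebra_isAlgebra.Build k free_alg free_scalerAr.

Definition gen (x : X) : free_alg := locked (<< fmu x >> : F0).

Section Eval.
Variables (B : algType k) (h : X -> B).

Definition word_eval (m : fmonom X) : B := \prod_(x <- m) h x.

Lemma word_eval_mmorphism : mmorphism word_eval.
Proof.
split=> [m1 m2|]; rewrite /word_eval; first by rewrite fmM big_cat.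
by rewrite fm1 big_nil.
Qed.

HB.instance Definition _ :=
  monalg.isMultiplicative.Build (fmonom X) B word_eval word_eval_mmorphism.

Definition free_eval : free_alg -> B := mmap (in_alg B) word_eval.

Lemma free_eval_zmod_morphism : zmod_morphism free_eval.
Proof. exact: (raddfB (mmap (in_alg B) word_eval)). Qed.

Lemma free_eval_monoid_morphism : monoid_morphism free_eval.
Proof.
have [|fM f1] := @commr_mmap_is_multiplicative _ _ _ (in_alg B) word_eval.
  by move=> g m m'; rewrite /GRing.comm /= mulr_algl mulr_algr.
by split=> // u v; rewrite [u * v]free_mulE.
Qed.

Lemma free_eval_scalable : scalable free_eval.
Proof.
by move=> c x; rewrite [c *: x]free_scaleE /free_eval mmapZ /= mulr_algl.
Qed.

HB.instance Definition _ := GRing.isZmodMorphism.Build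
  free_alg B free_eval free_eval_zmod_morphism.
HB.instance Definition _ := GRing.isMonoidMorphism.Build
  free_alg B free_eval free_eval_monoid_morphism.
HB.instance Definition _ := GRing.isScalable.Build
  k free_alg B *:%R free_eval free_eval_scalable.

Lemma free_evalZ c x : free_eval (c *: x) = c *: free_eval x.
Proof. exact: free_eval_scalable. Qed.

Lemma free_eval_gen x : free_eval (gen x) = h x.
Proof.
rewrite /free_eval /gen -lock mmapU /= scale1r mul1r.
by rewrite /word_eval fmU big_seq1.
Qed.

End Eval.
End FreeAlgebra.

Section Quotient.
Variables (k : fieldType) (X : choiceType).
Local Notation F := (free_alg k X).
Variable r : F -> Prop.

(* The two-sided ideal of k<X> generated by r. *)
Definition ideal_gen : pred F := fun x =>
  `[< exists s : seq (F * F * F), (forall y, y \in s -> r y.1.2) /\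
        x = \sum_(y <- s) y.1.1 * y.1.2 * y.2 >].

Lemma ideal_genP x : reflect
  (exists s : seq (F * F * F), (forall y, y \in s -> r y.1.2) /\
        x = \sum_(y <- s) y.1.1 * y.1.2 * y.2) (x \in ideal_gen).
Proof. exact: asboolP. Qed.

Lemma ideal_gen_zmod : zmod_closed ideal_gen.
Proof.
split; first by apply/ideal_genP; exists [::]; rewrite big_nil.
move=> x y /ideal_genP[s [rs ->]] /ideal_genP[t [rt ->]]; apply/ideal_genP.
exists (s ++ [seq (- z.1.1, z.1.2, z.2) | z <- t]); split=> [z|].
  rewrite mem_cat => /orP[/rs //|/mapP[w wt ->]]; exact: (rt w).
rewrite big_cat big_map /=; congr (_ + _); rewrite -sumrN.
by apply: eq_bigr => z _ /=; rewrite !mulNr.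
Qed.

HB.instance Definition _ := GRing.isZmodClosed.Build F ideal_gen ideal_gen_zmod.

Lemma ideal_gen_mull u x : x \in ideal_gen -> u * x \in ideal_gen.
Proof.
move=> /ideal_genP[s [rs ->]]; apply/ideal_genP.
exists [seq (u * z.1.1, z.1.2, z.2) | z <- s]; split=> [z /mapP[w ws ->]|].
  exact: (rs w).
by rewrite big_map mulr_sumr; apply: eq_bigr => z _ /=; rewrite !mulrA.
Qed.

Lemma ideal_gen_mulr u x : x \in ideal_gen -> x * u \in ideal_gen.
Proof.
move=> /ideal_genP[s [rs ->]]; apply/ideal_genP.
exists [seq (z.1.1, z.1.2, z.2 * u) | z <- s]; split=> [z /mapP[w ws ->]|].
  exact: (rs w).
by rewrite big_map mulr_suml; apply: eq_bigr => z _; apply/esym/mulrA.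
Qed.

Lemma ideal_gen_rel x : r x -> x \in ideal_gen.
Proof.
move=> rx; apply/ideal_genP; exists [:: (1, x, 1)].
by rewrite big_seq1 mulr1 mul1r; split=> // y /[!inE] /eqP ->.
Qed.

Lemma ideal_genZ (c : k) x : x \in ideal_gen -> c *: x \in ideal_gen.
Proof. by move=> xI; rewrite -mulr_algl; apply: ideal_gen_mull. Qed.

(* The algebra with generators X and relations x = 0 for r x. *)
Definition presented :=
  @Quotient.quot F (GRing.ZmodClosed.clone F ideal_gen _).

HB.instance Definition _ := GRing.Zmodule.on presented.
HB.instance Definition _ := EqQuotient.on presented.

Local Notation proj := (\pi_presented : F -> presented).

Lemma proj_eq x y : (proj x == proj y) = (x - y \in ideal_gen).
Proof. by rewrite -Quotient.idealrBE. Qed.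

Lemma proj_eqP x y : x - y \in ideal_gen -> proj x = proj y.
Proof. by rewrite -proj_eq => /eqP. Qed.

Lemma reprB x : repr (proj x) - x \in ideal_gen.
Proof. by rewrite -proj_eq reprK. Qed.

Lemma proj_add : {morph proj : x y / x + y}.
Proof. exact: Quotient.pi_add. Qed.

Definition presented_one : presented := proj 1.
Definition presented_mul : presented -> presented -> presented :=
  lift_op2 presented *%R.
Definition presented_scale : k -> presented -> presented :=
  locked (fun c x => proj (c *: repr x)).

Lemma proj_mul : {morph proj : x y / x * y >-> presented_mul x y}.
Proof.
move=> x y; rewrite /presented_mul; unlock; apply/esym/proj_eqP.
have -> : repr (proj x) * repr (proj y) - x * y =
  (repr (proj x) - x) * repr (proj y) + x * (repr (proj y) - y).
  by rewrite mulrBl mulrBr addrA subrK.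
by apply: rpredD; [apply: ideal_gen_mulr|apply: ideal_gen_mull]; apply: reprB.
Qed.

Lemma proj_scale c : {morph proj : x / c *: x >-> presented_scale c x}.
Proof.
by move=> x; rewrite /presented_scale -lock; apply/esym/proj_eqP; rewrite -scalerBr; apply/ideal_genZ/reprB.
Qed.

Lemma projP a : exists x, a = proj x.
Proof. by exists (repr a); rewrite reprK. Qed.

Lemma presented_mulA : associative presented_mul.
Proof.
move=> a b c; have [x ->] := projP a; have [y ->] := projP b.
by have [z ->] := projP c; rewrite -!(proj_mul _ _) (mulrA x y z).
Qed.

Lemma presented_mul1 : left_id presented_one presented_mul.
Proof. by move=> a; have [x ->] := projP a; rewrite -(proj_mul 1 x) mul1r. Qed.

Lemma presented_mulr1 : right_id presented_one presented_mul.
Proof. by move=> a; have [x ->] := projP a; rewrite -(proj_mul x 1) mulr1. Qed.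

Lemma presented_mulDl : left_distributive presented_mul +%R.
Proof.
move=> a b c; have [x ->] := projP a; have [y ->] := projP b.
have [z ->] := projP c.
by rewrite -(proj_add x y) -!(proj_mul _ _) -(proj_add (x * z)) mulrDl.
Qed.

Lemma presented_mulDr : right_distributive presented_mul +%R.
Proof.
move=> a b c; have [x ->] := projP a; have [y ->] := projP b.
have [z ->] := projP c.
by rewrite -(proj_add y z) -!(proj_mul _ _) -(proj_add (x * y)) mulrDr.
Qed.

HB.instance Definition _ := GRing.Zmodule_isPzRing.Build presented
  presented_mulA presented_mul1 presented_mulr1
  presented_mulDl presented_mulDr.

Lemma presented_scalerA a b v :
  presented_scale a (presented_scale b v) = presented_scale (a * b) v.
Proof. by have [x ->] := projP v; rewrite -!(proj_scale _ _) scalerA. Qed.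

Lemma presented_scale1 : left_id 1 presented_scale.
Proof. by move=> v; have [x ->] := projP v; rewrite -(proj_scale 1 x) scale1r. Qed.

Lemma presented_scaleDr : right_distributive presented_scale +%R.
Proof.
move=> c a b; have [x ->] := projP a; have [y ->] := projP b.
by rewrite -(proj_add x y) -!(proj_scale _ _) -(proj_add (c *: x)) scalerDr.
Qed.

Lemma presented_scaleDl v : {morph presented_scale^~ v : a b / a + b}.
Proof.
move=> a b; have [x ->] := projP v.
by rewrite -!(proj_scale _ _) -(proj_add (a *: x)) scalerDl.
Qed.

HB.instance Definition _ := GRing.Zmodule_isLmodule.Build k presented
  presented_scalerA presented_scale1 presented_scaleDr presented_scaleDl.

Lemma projM x y : proj (x * y) = proj x * proj y.
Proof. exact: proj_mul. Qed.

Lemma projZ c x : proj (c *: x) = c *: proj x.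
Proof. exact: proj_scale. Qed.

Lemma presented_scalerAl c (a b : presented) : c *: (a * b) = (c *: a) * b.
Proof.
have [x ->] := projP a; have [y ->] := projP b.
by rewrite -(projM x y) -!(projZ c) -(projM (c *: x) y) scalerAl.
Qed.

Lemma presented_scalerAr c (a b : presented) : c *: (a * b) = a * (c *: b).
Proof.
have [x ->] := projP a; have [y ->] := projP b.
by rewrite -(projM x y) -!(projZ c) -(projM x (c *: y)) free_scalerAr.
Qed.

Section Lift.
Variables (B : algType k) (h : X -> B).
Hypothesis hr : forall x, r x -> free_eval h x = 0.

Definition presented_lift (a : presented) : B := free_eval h (repr a).

Lemma presented_liftE x : presented_lift (proj x) = free_eval h x.
Proof.
apply/eqP; rewrite -subr_eq0 -rmorphB /=.
have /ideal_genP[s [rs ->]] := reprB x.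
rewrite rmorph_sum big_seq big1 // => y /rs ry.
by rewrite !rmorphM /= (hr ry) mulr0 mul0r.
Qed.

Lemma presented_lift_zmod_morphism : zmod_morphism presented_lift.
Proof.
move=> a b; have [x ->] := projP a; have [y ->] := projP b.
have -> : proj x - proj y = proj (x - y).
  by rewrite (proj_add x) (Quotient.pi_opp _ y).
by rewrite !presented_liftE rmorphB.
Qed.

Lemma presented_lift_monoid_morphism : monoid_morphism presented_lift.
Proof.
split=> [|a b]; first by rewrite presented_liftE rmorph1.
have [x ->] := projP a; have [y ->] := projP b.
by rewrite -(projM x y) !presented_liftE rmorphM.
Qed.

Lemma presented_lift_scalable : scalable presented_lift.
Proof.
move=> c a; have [x ->] := projP a.
by rewrite -(projZ c x) !presented_liftE free_evalZ.
Qed.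

End Lift.
End Quotient.

(* Restriction of scalars along phi. *)
Definition restr (A B : pzRingType) (phi : {rmorphism A -> B})
  (V : lmodType B) : Type := V.

Section Restriction.
Variables (A B : pzRingType) (phi : {rmorphism A -> B}) (V : lmodType B).
Local Notation restr := (restr phi V).

HB.instance Definition _ := GRing.Zmodule.on restr.

Definition restr_scale (a : A) (v : restr) : restr := phi a *: (v : V).

Lemma restr_scalerA a b v : restr_scale a (restr_scale b v) = restr_scale (a * b) v.
Proof. by rewrite /restr_scale rmorphM scalerA. Qed.
Lemma restr_scale1r : left_id 1 restr_scale.
Proof. by move=> v; rewrite /restr_scale rmorph1 scale1r. Qed.
Lemma restr_scalerDr : right_distributive restr_scale +%R.
Proof. by move=> a u v; apply: (@scalerDr B V). Qed.
Lemma restr_scalerDl v : {morph restr_scale^~ v : a b / a + b}.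
Proof. by move=> a b; rewrite /restr_scale rmorphD; apply: (@scalerDl B V). Qed.

HB.instance Definition _ := GRing.Zmodule_isLmodule.Build A restr
  restr_scalerA restr_scale1r restr_scalerDr restr_scalerDl.
End Restriction.

Section Modules.
Variable (A : pzRingType).
Implicit Types (M N P : lmodType A).

Definition mod_iso M N : Prop := exists f : {linear M -> N}, bijective f.

Definition direct_sum M (U V : {pred M}) : Prop :=
  (forall m, exists u v, [/\ u \in U, v \in V & m = u + v]) /\
  (forall m, m \in U -> m \in V -> m = 0).

Definition simple_mod M : Prop :=
  (exists m : M, m != 0) /\
  forall U : {pred M}, submod_closed U -> U =i pred1 0 \/ U =i predT.

Definition indecomposable_mod M : Prop :=
  (exists m : M, m != 0) /\
  forall U V : {pred M}, submod_closed U -> submod_closed V ->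
    direct_sum U V -> U =i pred1 0 \/ V =i pred1 0.

Definition short_exact M N P (f : {linear M -> N}) (g : {linear N -> P}) : Prop :=
  [/\ injective f, forall z, exists y, g y = z
    & forall y, g y = 0 <-> exists x, f x = y].
End Modules.

(* The subspace U of M has dimension d over k, where k acts on M through
   c |-> c%:A. *)
Definition dim_is (k : fieldType) (A : algType k) (M : lmodType A)
    (U : {pred M}) (d : nat) : Prop :=
  exists b : 'I_d -> M, (forall i, b i \in U) /\
    forall m, m \in U -> exists! c : 'rV[k]_d, m = \sum_i (c 0 i)%:A *: b i.

Definition is_transposition n (s : 'S_n) : bool :=
  [exists x, exists y, (x != y) && (s == tperm x y)].

Definition transposition n := {s : 'S_n | is_transposition s}.

Section HQ.
Variables (k : fieldType) (n : nat).

Local Notation X := ('S_n + transposition n)%type.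
Local Notation F := (free_alg k X).
Local Notation H t := (gen k (inl t : X)).
Local Notation a i := (gen k (inr i : X)).

(* The product of 'S_n is composition in diagrammatic order, opposite to the
   usual one; only the abstract group law enters the presentation, and
   t |-> t^-1 identifies both conventions (it fixes transpositions and
   preserves the sign). For n = 3 the parameter La does not occur. *)
Inductive HQ_rel (La Ga : k) : F -> Prop :=
| HQ_rel_one : HQ_rel La Ga (H 1%g - 1)
| HQ_rel_mul t s : HQ_rel La Ga (H t * H s - H (t * s)%g)
| HQ_rel_conj t i j : val j = (t * val i * t^-1)%g ->
    HQ_rel La Ga (H t * a i - (-1) ^+ t *: (a j * H t))
| HQ_rel_sqr i : HQ_rel La Ga (a i * a i)
| HQ_rel_comm i j : i != j -> commute (val i) (val j) ->
    HQ_rel La Ga (a i * a j + a j * a i - La *: (1 - H (val i) * H (val j)))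
| HQ_rel_ncomm i j l : ~ commute (val i) (val j) ->
    val l = (val i * val j * val i)%g ->
    HQ_rel La Ga (a i * a j + a l * a i + a j * a l
                  - Ga *: (1 - H (val i) * H (val j))).

Variables (La Ga : k).

Definition HQ := presented (HQ_rel La Ga).
HB.instance Definition _ := GRing.PzRing.on HQ.
HB.instance Definition _ := GRing.Lmodule.on HQ.

Definition HQ_H (t : 'S_n) : HQ := \pi_HQ (H t).
Definition HQ_a (i : transposition n) : HQ := \pi_HQ (a i).

Lemma HQ_rel_eval (B : algType k) (h : X -> B) :
  h (inl 1%g) = 1 ->
  (forall t s, h (inl t) * h (inl s) = h (inl (t * s)%g)) ->
  (forall t i j, val j = (t * val i * t^-1)%g ->
     h (inl t) * h (inr i) = (-1) ^+ t *: (h (inr j) * h (inl t))) ->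
  (forall i, h (inr i) * h (inr i) = 0) ->
  (forall i j, i != j -> commute (val i) (val j) ->
     h (inr i) * h (inr j) + h (inr j) * h (inr i) =
     La *: (1 - h (inl (val i)) * h (inl (val j)))) ->
  (forall i j l, ~ commute (val i) (val j) ->
     val l = (val i * val j * val i)%g ->
     h (inr i) * h (inr j) + h (inr l) * h (inr i) + h (inr j) * h (inr l) =
     Ga *: (1 - h (inl (val i)) * h (inl (val j)))) ->
  forall x, HQ_rel La Ga x -> free_eval h x = 0.
Proof.
move=> h1 hM hJ ha hc hn _ [|t s|t i j tij|i|i j ij cij|i j l cij lij].
- by rewrite rmorphB rmorph1 /= free_eval_gen h1 subrr.
- by rewrite rmorphB rmorphM /= !free_eval_gen hM subrr.
- by rewrite rmorphB /= free_evalZ !rmorphM /= !free_eval_gen (hJ t i j tij) subrr.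
- by rewrite rmorphM /= free_eval_gen ha.
- rewrite rmorphB rmorphD /= free_evalZ rmorphB !rmorphM rmorph1 /=.
  by rewrite !free_eval_gen (hc i j) // subrr.
- rewrite rmorphB !rmorphD /= free_evalZ rmorphB !rmorphM rmorph1 /=.
  by rewrite !free_eval_gen (hn i j l) // subrr.
Qed.

End HQ.

Inductive lin_char := Eps | Sgn.

Definition char_val (k : fieldType) n (rho : lin_char) (t : 'S_n) : k :=
  match rho with Eps => 1 | Sgn => (-1) ^+ t end.

Section HQModules.
Variables (k : fieldType) (n : nat) (La Ga : k).
Local Notation X := ('S_n + transposition n)%type.

Definition S_fun (rho : lin_char) (x : X) : k^o :=
  match x with inl t => char_val k rho t | inr _ => 0 end.

Lemma char_val1 rho : char_val k rho (1%g : 'S_n) = 1.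
Proof. by case: rho; rewrite //= odd_perm1. Qed.

Lemma char_valM rho (t s : 'S_n) :
  char_val k rho (t * s)%g = char_val k rho t * char_val k rho s.
Proof. by case: rho; rewrite /= ?mulr1 // odd_permM signr_addb. Qed.

Lemma char_val_transposition rho (i j : transposition n) :
  char_val k rho (val i) * char_val k rho (val j) = 1.
Proof.
have oddT (l : transposition n) : odd_perm (val l).
  case: l => l /= /existsP[x /existsP[y /andP[xy /eqP ->]]].
  by rewrite odd_tperm.
by case: rho; rewrite /= ?mulr1 // !oddT mulrNN mulr1.
Qed.

Lemma S_fun_rel rho x : HQ_rel La Ga x -> free_eval (S_fun rho) x = 0.
Proof.
have vT i j := char_val_transposition rho i j.
by apply: HQ_rel_eval => [|t s|t i j _|i|i j _ _|i j l _ _] /=;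
  rewrite ?char_val1 ?char_valM ?vT ?subrr ?scaler0 ?mulr0 ?mul0r
    ?mulr0 ?scaler0 ?addr0.
Qed.

Definition S_lift (rho : lin_char) : HQ n La Ga -> k^o :=
  presented_lift (r := HQ_rel La Ga) (S_fun rho).

HB.instance Definition _ rho := GRing.isZmodMorphism.Build
  (HQ n La Ga) k^o (S_lift rho)
  (presented_lift_zmod_morphism (@S_fun_rel rho)).
HB.instance Definition _ rho := GRing.isMonoidMorphism.Build
  (HQ n La Ga) k^o (S_lift rho)
  (presented_lift_monoid_morphism (@S_fun_rel rho)).

Lemma S_lift_H rho t : S_lift rho (HQ_H La Ga t) = char_val k rho t.
Proof.
by rewrite /S_lift /HQ_H (presented_liftE (@S_fun_rel rho)) free_eval_gen.
Qed.

Lemma S_lift_a rho i : S_lift rho (HQ_a La Ga i) = 0.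
Proof.
by rewrite /S_lift /HQ_a (presented_liftE (@S_fun_rel rho)) free_eval_gen.
Qed.

Lemma HQ_oner_neq0 : (1 : HQ n La Ga) != 0.
Proof.
apply/eqP => /(congr1 (S_lift Eps)) /eqP.
by rewrite (rmorph1 (S_lift Eps)) (raddf0 (S_lift Eps)) oner_eq0.
Qed.

HB.instance Definition _ :=
  GRing.PzSemiRing_isNonZero.Build (HQ n La Ga) HQ_oner_neq0.
HB.instance Definition _ := GRing.Lmodule_isLalgebra.Build k (HQ n La Ga)
  (@presented_scalerAl k _ (@HQ_rel k n La Ga)).
HB.instance Definition _ := GRing.Lalgebra_isAlgebra.Build k (HQ n La Ga)
  (@presented_scalerAr k _ (@HQ_rel k n La Ga)).

Definition S_mod (rho : lin_char) : lmodType (HQ n La Ga) :=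
  restr (S_lift rho) k^o.

Lemma S_modE rho (a : HQ n La Ga) (x : S_mod rho) :
  a *: x = (S_lift rho a * (x : k^o) : k^o).
Proof. by []. Qed.

(* M[rho]: as rho is one-dimensional, its isotypic component is the set of
   vectors on which every H_t acts as the scalar rho(t). *)
Definition isotypic (rho : lin_char) (M : lmodType (HQ n La Ga)) : {pred M} :=
  [pred m | [forall t : 'S_n,
     HQ_H La Ga t *: m == (char_val k rho t)%:A *: m]].

(* M = M[Eps] (+) M[Sgn] with dim M[Eps] = p and dim M[Sgn] = q. *)
Definition eps_sgn_type (M : lmodType (HQ n La Ga)) (p q : nat) : Prop :=
  [/\ direct_sum (@isotypic Eps M) (@isotypic Sgn M),
      dim_is (@isotypic Eps M) p & dim_is (@isotypic Sgn M) q].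

Definition indec_ext (rho mu : lin_char) (N : lmodType (HQ n La Ga)) : Prop :=
  indecomposable_mod N /\
  exists (f : {linear S_mod mu -> N}) (g : {linear N -> S_mod rho}),
    short_exact f g.

(* N is M_{rho,mu}; the second half is its uniqueness. *)
Definition is_M (rho mu : lin_char) (N : lmodType (HQ n La Ga)) : Prop :=
  indec_ext rho mu N /\ forall N', indec_ext rho mu N' -> mod_iso N' N.

End HQModules.

Arguments S_mod {k n La Ga} rho.

(* Main.v *)
(* Let rho, mu be the two characters, in either order. On a vector of weight
   rho, H_i a_i = - a_i H_i forces a_i to map it to weight mu, and then
   conjugation by S_n forces all the a_i to act by one and the same operator
   a, with a^2 = 0. So a module of the given type is a pair of spaces with maps
   M[Eps] <-> M[Sgn] whose composites vanish. If a x <> 0 for some x of weight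
   rho, take a functional phi that is 1 on a x and 0 on M[rho]:
   {m | phi m = phi (a m) = 0} is a submodule complementing span(x, a x). If
   a = 0, any line spanned by a weight vector splits off. Conversely an
   extension of S_rho by S_mu becomes a module of this type by averaging a
   lift of the generator over S_n. *)
From HB Require Import structures.
Require Import Defs.
From mathcomp Require Import all_boot all_order all_algebra all_fingroup.
From mathcomp Require Import monalg boolp.

Set Implicit Arguments.
Unset Strict Implicit.
Unset Printing Implicit Defensive.

Import GRing.Theory.
Local Open Scope ring_scope.

(** An element is a sum of scaled words, and a word is built from 1 by multiplying letters on the
    left. *)
Lemma free_alg_ind (k : fieldType) (X : choiceType) (P : free_alg k X -> Prop) :
  P 1 -> (forall u v, P u -> P v -> P (u + v)) ->
  (forall c u, P u -> P (c *: u)) ->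
  (forall x u, P u -> P (gen k x * u)) -> forall u, P u.
Proof.
move=> P1 PD PZ PM; have P0 : P 0 by rewrite -(scale0r 1); apply: PZ.
have PU (s : seq X) : P (<< FMonom s >> : {malg k[{fmonom X}]}).
  elim: s => [|x s IHs]; first by rewrite -fmoneE.
  suff -> : (<< FMonom (x :: s) >> : {malg k[{fmonom X}]}) =
    gen k x * (<< FMonom s >> : {malg k[{fmonom X}]}) by apply: PM.
  rewrite /gen -lock [RHS]free_mulE malgM_def fgmulUU mulr1.
  by rewrite fmuE /mmul /= fmmulE.
move=> u; rewrite [u](monalgE u).
apply: (big_ind P) => // -[s] _; move: (u@__) => c.
suff -> : (<< c *g FMonom s >> : {malg k[{fmonom X}]}) =
  c *: (<< FMonom s >> : free_alg k X) by apply: PZ.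
rewrite [RHS]free_scaleE; apply/malgP => w.
by rewrite mcoeffZ !mcoeffU mulr_natr.
Qed.

(** * Generators and relations *)

Section Presentation.
Variables (k : fieldType) (n : nat) (La Ga : k).
Local Notation A := (HQ n La Ga).
Local Notation H := (@HQ_H k n La Ga).
Local Notation a := (@HQ_a k n La Ga).

Lemma HQ_ind (P : A -> Prop) :
  P 1 -> (forall u v, P u -> P v -> P (u + v)) ->
  (forall c u, P u -> P (c *: u)) ->
  (forall t u, P u -> P (H t * u)) -> (forall i u, P u -> P (a i * u)) ->
  forall u, P u.
Proof.
move=> P1 PD PZ PH Pa u; have [x ->] := projP u.
elim/free_alg_ind: x => [//|x y Px Py|c x Px|[t|i] x Px].
- by rewrite proj_add; apply: PD.
- by rewrite projZ; apply: PZ.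
- by rewrite projM; apply: PH.
- by rewrite projM; apply: Pa.
Qed.

Lemma HQ_HM t s : H t * H s = H (t * s)%g.
Proof.
rewrite /HQ_H -projM; exact/proj_eqP/ideal_gen_rel/HQ_rel_mul.
Qed.

Lemma HQ_Ha t i j : val j = (t * val i * t^-1)%g ->
  H t * a i = (-1) ^+ t *: (a j * H t).
Proof.
move=> tij; rewrite /HQ_H /HQ_a -!projM -projZ.
by apply/proj_eqP/ideal_gen_rel/HQ_rel_conj.
Qed.

Lemma HQ_aa i : a i * a i = 0.
Proof.
(* This relator is not a difference, while [proj_eqP] compares two elements; adding [a i * a i] to
   both sides provides them. *)
apply: (addrI (a i * a i)); rewrite addr0 /HQ_a -projM -proj_add.
by apply: proj_eqP; rewrite addrK; apply/ideal_gen_rel/HQ_rel_sqr.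
Qed.

(** This is the generation principle assumed as [gen_ind] in the abstract treatment of modules. *)
Lemma HQ_scalar_ind (P : A -> Prop) :
  (forall c : k, P c%:A) -> (forall t, P (H t)) -> (forall i, P (a i)) ->
  (forall u v, P u -> P v -> P (u + v)) ->
  (forall u v, P u -> P v -> P (u * v)) -> forall u, P u.
Proof.
move=> PA PH Pa PD PM; elim/HQ_ind => //.
- by rewrite -(scale1r 1).
- by move=> c u Pu; rewrite -mulr_algl; apply: PM.
- by move=> t u; apply: PM.
- by move=> i u; apply: PM.
Qed.

End Presentation.

(** * Scalars acting through [c%:A], and dimensions *)

Section ScalarAction.
Variables (k : fieldType) (A : algType k) (M : lmodType A).
Implicit Types (m : M) (c d : k).

Lemma algZA c d m : c%:A *: (d%:A *: m) = (c * d)%:A *: m.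
Proof. by rewrite scalerA -scalerAl mul1r scalerA. Qed.

Lemma algZC c (h : A) m : h *: (c%:A *: m) = c%:A *: (h *: m).
Proof. by rewrite !scalerA mulr_algl mulr_algr. Qed.

Lemma algZZ c (h : A) m : (c *: h) *: m = c%:A *: (h *: m).
Proof. by rewrite scalerA mulr_algl. Qed.

Lemma algZ1 m : (1 : k)%:A *: m = m.
Proof. by rewrite !scale1r. Qed.

Lemma algZ0 m : (0 : k)%:A *: m = 0.
Proof. by rewrite !scale0r. Qed.

Lemma algZDl c d m : (c + d)%:A *: m = c%:A *: m + d%:A *: m.
Proof. by rewrite !scalerDl. Qed.

Lemma algZN c m : (- c)%:A *: m = - (c%:A *: m).
Proof. by rewrite !scaleNr. Qed.

Lemma algZ_eq0 c m : (c%:A *: m == 0) = (c == 0) || (m == 0).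
Proof.
have [->|c0] := eqVneq c 0; first by rewrite algZ0 eqxx.
apply/eqP/eqP => [cm|->]; last by rewrite scaler0.
by rewrite -[m]algZ1 -(mulVf c0) -algZA cm scaler0.
Qed.

Lemma algZI c : c != 0 -> injective (fun m => c%:A *: m).
Proof.
move=> c0 m m' E; apply/eqP; rewrite -subr_eq0.
have /eqP := E; rewrite -subr_eq0 -scalerBr algZ_eq0 (negPf c0) /=.
by [].
Qed.

Lemma algZIl m : m != 0 -> injective (fun c => c%:A *: m).
Proof.
move=> m0 c d /eqP; rewrite -subr_eq0 -algZN -algZDl algZ_eq0 (negPf m0) orbF.
by rewrite subr_eq0 => /eqP.
Qed.

Lemma dim_is1 (U : {pred M}) e : e \in U -> e != 0 ->
  (forall m, m \in U -> exists c : k, m = c%:A *: e) -> dim_is U 1.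
Proof.
move=> eU e0 Ue; exists (fun=> e); split=> // m /Ue[c ->]; exists (c%:M).
split=> [|c']; first by rewrite big_ord1 mxE.
rewrite big_ord1 => /(algZIl e0) ->; apply/rowP => i.
by rewrite !ord1 mxE eqxx.
Qed.

Lemma dim_is1_gen (U : {pred M}) : dim_is U 1 ->
  exists e, [/\ e \in U, e != 0 &
    forall m, m \in U -> exists c : k, m = c%:A *: e].
Proof.
move=> [b [bU Ub]]; exists (b 0); split=> // [|m /Ub[c [-> _]]]; last first.
  by exists (c 0 0); rewrite big_ord1.
(* If the basis vector were 0, the coordinates 0 and 1 would both represent it. *)
apply/eqP => b0; have [c [_ cU]] := Ub _ (bU 0).
have c0 : c = 0 by apply: cU; rewrite big_ord1 b0 scaler0.
have /cU : b 0 = \sum_i ((const_mx 1 : 'rV[k]_1) 0 i)%:A *: b i.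
  by rewrite big_ord1 b0 scaler0.
rewrite c0 => /rowP/(_ 0)/eqP.
by rewrite !mxE eq_sym oner_eq0.
Qed.

Lemma dim_is_gen (U : {pred M}) e p : 0 \in U -> e \in U -> e != 0 ->
  (forall m, m \in U -> exists c : k, m = c%:A *: e) -> dim_is U p -> p = 1%N.
Proof.
move=> U0 eU e0 Ue [b [bU Ub]].
have [c bc] : {c : 'I_p -> k & forall i, b i = (c i)%:A *: e}.
  by apply: (@choice _ _ (fun i ci => b i = ci%:A *: e)) => i; apply: Ue.
(* Coordinates are unique, so the p coefficients of the b i along e are a
   column without left kernel: p <= 1. *)
have free_c : row_free (\col_i c i).
  apply: inj_row_free => r /matrixP/(_ 0 0); rewrite !mxE => r0.
  have [s [_ sU]] := Ub _ U0.
  have <- : s = r.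
    apply: sU; rewrite (eq_bigr (fun i => (r 0 i * (\col_j c j) i 0)%:A *: e)).
      by rewrite -!scaler_suml r0 algZ0.
    by move=> i _; rewrite mxE bc algZA.
  by apply: sU; rewrite big1 // => i _; rewrite mxE algZ0.
have := rank_leq_col (\col_i c i); rewrite (eqP free_c).
(* The rank bound excludes [p >= 2]; for [p = 0] the vector [e] would be an empty sum. *)
case: p b c bU Ub {bc free_c} => [|[|p]] // b _ _ /(_ _ eU)[r [E _]] _.
by rewrite E big_ord0 eqxx in e0.
Qed.

End ScalarAction.

(** * The two characters and the class of transpositions *)

Definition dual rho := match rho with Eps => Sgn | Sgn => Eps end.

Lemma dualK : involutive dual.
Proof. by case. Qed.

Lemma odd_transposition n (i : transposition n) : odd_perm (val i).
Proof.
by case: i => i /= /existsP[x /existsP[y /andP[xy /eqP ->]]]; rewrite odd_tperm.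
Qed.

Lemma transposition_conj n (i j : transposition n) :
  exists t, val j = (t * val i * t^-1)%g.
Proof.
case: i j => [i /= /existsP[a /existsP[b /andP[ab /eqP ->]]]].
case=> [j /= /existsP[c /existsP[d /andP[cd /eqP ->]]]].
(* Products act from left to right: the first factor moves [a] to [c], the second fixes [c] and
   moves the image of [b] to [d]. Since [tpermJ] conjugates as [s^-1 * _ * s], the witness is
   [s^-1]. *)
pose s := (tperm a c * tperm (tperm a c b) d)%g.
have sa : s a = c.
  have bc : tperm a c b != c.
    by rewrite -[X in _ != X](tpermL a c) (inj_eq perm_inj) eq_sym.
  by rewrite permM tpermL tpermD // eq_sym.
have sb : s b = d by rewrite permM tpermL.
exists s^-1%g; rewrite invgK -mulgA.
by have := tpermJ a b s; rewrite /conjg => ->; rewrite sa sb.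
Qed.

Lemma conj_transposition n (t : 'S_n) (i : transposition n) :
  exists j : transposition n, val j = (t * val i * t^-1)%g.
Proof.
suff tP : is_transposition (t * val i * t^-1)%g by exists (Sub _ tP).
case: i => s /= /existsP[x /existsP[y /andP[xy /eqP ->]]].
apply/existsP; exists (t^-1%g x); apply/existsP; exists (t^-1%g y).
rewrite (inj_eq perm_inj) xy /=; apply/eqP.
by rewrite -tpermJ /conjg invgK mulgA.
Qed.

Lemma transposition_exists n : (2 <= n)%N -> exists i : transposition n, True.
Proof.
case: n => [|[|n]] // _.
have H : is_transposition (tperm 0 1 : 'S_n.+2).
  by apply/existsP; exists 0; apply/existsP; exists 1; rewrite eqxx.
by exists (Sub (tperm 0 1) H).
Qed.

Section CharVal.
Variables (k : fieldType) (n : nat).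

Lemma char_val_sq rho (t : 'S_n) : char_val k rho t * char_val k rho t = 1.
Proof. by case: rho; rewrite /= ?mulr1 // -expr2 sqrr_sign. Qed.

Lemma char_val_neq0 rho (t : 'S_n) : char_val k rho t != 0.
Proof.
apply/eqP => r0; have := char_val_sq rho t.
by rewrite r0 mul0r => /eqP; rewrite eq_sym oner_eq0.
Qed.

(** Thus [dual] is the product with the sign, not the contragredient: both characters are their own
    inverses. *)
Lemma char_val_dual rho (t : 'S_n) :
  char_val k (dual rho) t = (-1) ^+ t * char_val k rho t.
Proof. by case: rho; rewrite /= ?mulr1 // -expr2 sqrr_sign. Qed.

Lemma char_val_dual_transposition rho (i : transposition n) :
  char_val k (dual rho) (val i) = - char_val k rho (val i).
Proof. by rewrite char_val_dual odd_transposition mulN1r. Qed.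

End CharVal.

(** The action of [H t] on M_{rho, dual rho}, in a basis made of a vector of weight [rho] followed
    by its image under the [a_i]. *)
Definition ext_diag (k : fieldType) n rho (t : 'S_n) : 'M[k]_2 :=
  diag_mx (\row_i if i == 0 then char_val k rho t else char_val k (dual rho) t).

(** Column matrices come with [R] as scalars; the alias carries the structure whose scalars are the
    square matrices. *)
Definition colmod (R : nzRingType) (m : nat) : Type := 'cV[R]_m.+1.

Section ColMod.
Variables (R : nzRingType) (m : nat).
HB.instance Definition _ := GRing.Zmodule.on (colmod R m).

Definition colmod_scale (B : 'M[R]_m.+1) (v : colmod R m) : colmod R m := B *m v.

Lemma colmod_scalerA B C v :
  colmod_scale B (colmod_scale C v) = colmod_scale (B * C) v.
Proof. exact: mulmxA. Qed.
Lemma colmod_scale1r : left_id 1 colmod_scale.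
Proof. exact: mul1mx. Qed.
Lemma colmod_scalerDr : right_distributive colmod_scale +%R.
Proof. exact: mulmxDr. Qed.
Lemma colmod_scalerDl v : {morph colmod_scale^~ v : B C / B + C}.
Proof. by move=> B C; apply: mulmxDl. Qed.

HB.instance Definition _ := GRing.Zmodule_isLmodule.Build 'M[R]_m.+1 (colmod R m)
  colmod_scalerA colmod_scale1r colmod_scalerDr colmod_scalerDl.
End ColMod.

(** * Isomorphisms, simple and indecomposable modules *)

Section ModIso.
Variable A : pzRingType.

Lemma mod_iso_sym (M N : lmodType A) : mod_iso M N -> mod_iso N M.
Proof.
move=> [f [g gK fK]].
have gL : linear g by move=> h u v; apply: (can_inj gK); rewrite linearP !fK.
pose L := GRing.isLinear.Build A N M *:%R g gL.
pose G : {linear N -> M} := HB.pack g L.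
by exists G, f.
Qed.

Lemma simple_indecomposable (M : lmodType A) :
  simple_mod M -> indecomposable_mod M.
Proof.
move=> [M0 Ms]; split=> // U V Us Vs [_ UV].
have [U0|UT] := Ms U Us; [by left|right=> v].
apply/idP/eqP => [vV|->]; first by apply: UV; rewrite // UT.
by case: Vs.
Qed.

End ModIso.

(** * Weights *)

Section Modules.
Variables (k : fieldType) (n : nat) (A : algType k).
(** Modules are studied over an abstract algebra with these elements and identities, so that the
    quotient construction stays out of sight. *)
Variables (H : 'S_n -> A) (a : transposition n -> A).
Hypothesis gen_ind : forall P : A -> Prop,
  (forall c : k, P c%:A) -> (forall t, P (H t)) -> (forall i, P (a i)) ->
  (forall u v, P u -> P v -> P (u + v)) ->
  (forall u v, P u -> P v -> P (u * v)) -> forall u, P u.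
Hypothesis H_a : forall t i j, val j = (t * val i * t^-1)%g ->
  H t * a i = (-1) ^+ t *: (a j * H t).
Hypothesis aa0 : forall i, a i * a i = 0.
Local Notation chi := (@char_val k n).

(** The elements of [A] that preserve [U] are closed under sums and products, so it is enough to
    test generators. *)
Lemma gen_submod (M : lmodType A) (U : {pred M}) :
  0 \in U -> {in U &, forall u v, u + v \in U} ->
  (forall (c : k) u, u \in U -> c%:A *: u \in U) ->
  (forall t u, u \in U -> H t *: u \in U) ->
  (forall i u, u \in U -> a i *: u \in U) -> submod_closed U.
Proof.
move=> U0 UD UZ UH Ua; split=> // h u v uU vU; apply: (UD) => {v vU}//.
elim/gen_ind: h u uU => //.
- by move=> g h Ug Uh u uU; rewrite scalerDl; apply: UD; [apply: Ug|apply: Uh].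
- by move=> g h Ug Uh u uU; rewrite -scalerA; apply/Ug/Uh.
Qed.

(** Likewise, the elements of [A] that commute with [f] are closed under sums and products. *)
Lemma gen_linear (M N : lmodType A) (f : M -> N) :
  {morph f : u v / u + v} -> (forall (c : k) u, f (c%:A *: u) = c%:A *: f u) ->
  (forall t u, f (H t *: u) = H t *: f u) ->
  (forall i u, f (a i *: u) = a i *: f u) ->
  exists g : {linear M -> N}, g =1 f.
Proof.
move=> fD fZ fH fa.
have fL : linear f.
  move=> h u v; rewrite fD; congr (_ + _).
  elim/gen_ind: h u {v} => //.
  - by move=> g h fg fh u; rewrite !scalerDl fD fg fh.
  - by move=> g h fg fh u; rewrite -!scalerA fg fh.
pose L := GRing.isLinear.Build A M N *:%R f fL.
pose g : {linear M -> N} := HB.pack f L.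
by exists g.
Qed.

Implicit Types (M N : lmodType A) (rho : lin_char) (t : 'S_n).

Definition weight rho M (m : M) : Prop :=
  forall t, H t *: m = (chi rho t)%:A *: m.

(* Unfolds to [isotypic] of Defs when H is [HQ_H]. *)
Definition isotyp rho M : {pred M} :=
  [pred m | [forall t, H t *: m == (chi rho t)%:A *: m]].
Arguments isotyp rho M : clear implicits.

Lemma isotypP rho M (m : M) : reflect (weight rho m) (m \in isotyp rho M).
Proof. by apply: (iffP forallP) => w t; apply/eqP/w. Qed.

Lemma weight0 rho M : weight rho (0 : M).
Proof. by move=> t; rewrite !scaler0. Qed.

Lemma weightD rho M (u v : M) : weight rho u -> weight rho v -> weight rho (u + v).
Proof. by move=> wu wv t; rewrite !scalerDr wu wv. Qed.

Lemma weightZ rho M (c : k) (u : M) : weight rho u -> weight rho (c%:A *: u).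
Proof. by move=> wu t; rewrite algZC wu !algZA mulrC. Qed.

Lemma weightB rho M (u v : M) : weight rho u -> weight rho v -> weight rho (u - v).
Proof.
by move=> wu wv; rewrite -[v]algZ1 -algZN; apply/weightD/weightZ.
Qed.

Lemma weight_linear rho M N (f : {linear M -> N}) u :
  weight rho u -> weight rho (f u).
Proof. by move=> wu t; rewrite -!linearZ wu. Qed.

(** Moving [H t] past [a i] costs the sign of [t], which turns [rho] into the other character. *)
Lemma weight_Ha rho M (m : M) t i j : weight rho m ->
  val j = (t * val i * t^-1)%g ->
  H t *: (a i *: m) = (chi (dual rho) t)%:A *: (a j *: m).
Proof.
move=> wm tij; rewrite scalerA (H_a tij) algZZ -scalerA wm.
by rewrite algZC algZA char_val_dual.
Qed.

(** If [t] conjugates [i] to [j], then [H t *: (a i *: m)] is the same nonzero multiple of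
    [a i *: m] and, by [weight_Ha], of [a j *: m]. The weight of the [a l *: m] is a hypothesis
    because it has two sources: the type of the module, or the kernel of an extension. *)
Lemma weight_a_const rho M (m : M) i j : weight rho m ->
  (forall l, weight (dual rho) (a l *: m)) -> a i *: m = a j *: m.
Proof.
move=> wm wa; have [t tij] := transposition_conj i j.
apply: (algZI (char_val_neq0 k (dual rho) t)).
by rewrite /= -(weight_Ha wm tij) wa.
Qed.

(** An intrinsic form of being isomorphic to S_rho; see [lineP]. *)
Definition line rho M : Prop := exists y : M,
  [/\ weight rho y, forall i, a i *: y = 0, y != 0 &
      forall m, exists c : k, m = c%:A *: y].

(* For e = 1 this characterizes M_{rho, dual rho}, for e = 0 the direct sum of
   S_rho and S_(dual rho). *)
Definition bigen rho (e : k) M : Prop := exists x y : M,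
  [/\ weight rho x, weight (dual rho) y, x != 0 & y != 0] /\
  [/\ forall i, a i *: x = e%:A *: y, forall i, a i *: y = 0 &
      forall m, exists c d : k, m = c%:A *: x + d%:A *: y].

Lemma line_iso rho M N : mod_iso M N -> line rho M -> line rho N.
Proof.
move=> [f [g gK fK]] [y [wy ay y0 My]]; exists (f y); split.
- exact: weight_linear.
- by move=> i; rewrite -linearZZ ay linear0.
- by rewrite -(linear0 f) (can_eq gK).
- by move=> m; have [c E] := My (g m); exists c; rewrite -linearZZ -E fK.
Qed.

Lemma bigen_iso rho e M N : mod_iso M N -> bigen rho e M -> bigen rho e N.
Proof.
move=> [f [g gK fK]] [x [y [[wx wy x0 y0] [ax ay Mxy]]]]; exists (f x), (f y).
split; split; try exact: weight_linear.
- by rewrite -(linear0 f) (can_eq gK).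
- by rewrite -(linear0 f) (can_eq gK).
- by move=> i; rewrite -!linearZZ ax.
- by move=> i; rewrite -linearZZ ay linear0.
- move=> m; have [c [d E]] := Mxy (g m); exists c, d.
  by rewrite -!linearZZ -linearD -E fK.
Qed.

(** The coordinate along [y], obtained by choice and unique since [y] is nonzero, defines the
    map. *)
Lemma line_map rho M N (y : M) (z : N) :
  weight rho y -> (forall i, a i *: y = 0) -> y != 0 ->
  (forall m, exists c : k, m = c%:A *: y) ->
  weight rho z -> (forall i, a i *: z = 0) ->
  exists f : {linear M -> N}, f y = z.
Proof.
move=> wy ay y0 My wz az.
have [c cP] : {c : M -> k & forall m, m = (c m)%:A *: y}.
  exact: (@choice _ _ (fun m d => m = d%:A *: y)).
have cE m d : m = d%:A *: y -> c m = d.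
  by move=> E; apply: (algZIl y0); rewrite -cP.
have [||t m|i m|f fE] := @gen_linear M N (fun m => (c m)%:A *: z).
- by move=> u v; rewrite -algZDl; congr (_%:A *: _); apply: cE; rewrite algZDl -!cP.
- by move=> d u; rewrite algZA; congr (_%:A *: _); apply: cE; rewrite -algZA -cP.
- rewrite algZC wz algZA; congr (_%:A *: _); apply: cE.
  by rewrite {1}(cP m) algZC wy algZA.
- rewrite algZC az scaler0 (cE _ 0) ?algZ0 //.
  by rewrite (cP m) algZC ay scaler0.
by exists f; rewrite fE (cE _ 1) algZ1.
Qed.

Lemma line_unique rho M N : line rho M -> line rho N -> mod_iso M N.
Proof.
move=> [y [wy ay y0 My]] [z [wz az z0 Nz]].
have [f fy] := line_map wy ay y0 My wz az.
have [g gz] := line_map wz az z0 Nz wy ay.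
exists f, g => m; [have [c ->] := My m|have [c ->] := Nz m].
  by rewrite !linearZZ fy gz.
by rewrite !linearZZ gz fy.
Qed.

Lemma line_submod rho M (y : M) : weight rho y -> (forall i, a i *: y = 0) ->
  submod_closed [pred m | `[< exists c : k, m = c%:A *: y >]].
Proof.
move=> wy ay; apply: gen_submod.
- by apply/asboolP; exists 0; rewrite algZ0.
- move=> u v /asboolP[c ->] /asboolP[d ->]; apply/asboolP; exists (c + d).
  by rewrite algZDl.
- move=> d u /asboolP[c ->]; apply/asboolP; exists (d * c); by rewrite algZA.
- move=> t u /asboolP[c ->]; apply/asboolP; exists (c * chi rho t).
  by rewrite algZC wy algZA.
- move=> i u /asboolP[c ->]; apply/asboolP; exists 0.
  by rewrite algZC ay scaler0 algZ0.
Qed.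

Lemma submod_scale M (U : {pred M}) (h : A) u :
  submod_closed U -> u \in U -> h *: u \in U.
Proof. by move=> [U0 UD] uU; rewrite -[h *: u]addr0; apply: UD. Qed.

Lemma submod_nonzero M (U : {pred M}) : submod_closed U ->
  U =i pred1 0 \/ exists2 m, m \in U & m != 0.
Proof.
move=> [U0 _]; have [?|U'] := EM (exists2 m, m \in U & m != 0); first by right.
left=> m; apply/idP/eqP => [mU|-> //]; apply/eqP.
by apply: contrapT => /negP m0; apply: U'; exists m.
Qed.

Lemma line_simple rho M : line rho M -> simple_mod M.
Proof.
move=> [y [_ _ y0 My]]; split; first by exists y.
move=> U Us; have [|[m mU m0]] := submod_nonzero Us; [by left|right=> u].
have [c E] := My m; have [d ->] := My u.
have c0 : c != 0 by apply: contraNneq m0 => c0; rewrite E c0 algZ0.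
suff /(submod_scale (d%:A) Us) -> : y \in U by [].
by rewrite -[y]algZ1 -(mulVf c0) -algZA -E submod_scale.
Qed.

(** * Weights when 2 is nonzero in the field *)

Section Char2.
Hypotheses (two_neq0 : (2%:R : k) != 0) (n_ge2 : (2 <= n)%N).

(** A transposition acts on [m] by two opposite nonzero scalars. *)
Lemma weight_disjoint rho M (m : M) : weight rho m -> weight (dual rho) m -> m = 0.
Proof.
move=> w w'; have [i _] := transposition_exists n_ge2.
have := w' (val i); rewrite w char_val_dual_transposition algZN => /eqP.
rewrite -subr_eq0 opprK -algZDl -mulr2n -mulr_natr algZ_eq0 mulf_eq0.
by rewrite (negPf two_neq0) (negPf (char_val_neq0 _ _ _)) => /eqP.
Qed.

Lemma weight_free rho M (x y : M) (c d : k) : weight rho x -> weight (dual rho) y ->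
  x != 0 -> y != 0 -> c%:A *: x + d%:A *: y = 0 -> c = 0 /\ d = 0.
Proof.
move=> wx wy x0 y0 E.
have cx : c%:A *: x = 0.
  apply: (weight_disjoint (weightZ c wx)).
  have -> : c%:A *: x = (- d)%:A *: y by apply/eqP; rewrite algZN -addr_eq0 E.
  exact: weightZ.
move: E; rewrite cx add0r => /eqP; rewrite algZ_eq0 (negPf y0) orbF => /eqP ->.
by move/eqP: cx; rewrite algZ_eq0 (negPf x0) orbF => /eqP ->.
Qed.

Lemma direct_weights rho M :
  direct_sum (isotyp Eps M) (isotyp Sgn M) ->
  forall m : M, exists u v, [/\ weight rho u, weight (dual rho) v & m = u + v].
Proof.
move=> [dM _] m; have [u [v [/isotypP wu /isotypP wv E]]] := dM m.
by case: rho; [exists u, v|exists v, u; rewrite addrC].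
Qed.

(** * The action of the [a_i] on a module of the given type *)

Section Typed.
Variable M : lmodType A.
Hypothesis dM : direct_sum (isotyp Eps M) (isotyp Sgn M).

(** As [i] commutes with itself, [weight_Ha] gives the action of [H (val i)] on [a i *: m]. Since
    [M] is the sum of its two weight spaces, this single scalar already excludes a component of
    weight [rho]. *)
Lemma weight_a rho (m : M) i : weight rho m -> weight (dual rho) (a i *: m).
Proof.
move=> wm; have [u [v [wu wv E]]] := direct_weights rho dM (a i *: m).
suff u0 : u = 0 by rewrite E u0 add0r.
have iii : val i = (val i * val i * (val i)^-1)%g by rewrite mulgK.
have := weight_Ha wm iii; rewrite E !scalerDr wu wv => /addIr /eqP.
rewrite -subr_eq0 -algZN -algZDl char_val_dual_transposition opprK.
rewrite -mulr2n -mulr_natr algZ_eq0 mulf_eq0.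
by rewrite (negPf two_neq0) (negPf (char_val_neq0 _ _ _)) => /eqP.
Qed.

Lemma a_const i j (m : M) : a i *: m = a j *: m.
Proof.
have [u [v [wu wv ->]]] := direct_weights Eps dM m.
rewrite !scalerDr (weight_a_const i j wu); last by move=> l; apply: weight_a.
by rewrite (weight_a_const i j wv) // => l; apply: weight_a.
Qed.

Lemma a_a i j (m : M) : a i *: (a j *: m) = 0.
Proof. by rewrite (a_const i j) scalerA aa0 scale0r. Qed.

(** Apart from the sign, conjugation only changes the index of [a], and by [a_const] all indices act
    alike. *)
Lemma a_H i t (m : M) : a i *: (H t *: m) = ((-1) ^+ t : k)%:A *: (H t *: (a i *: m)).
Proof.
have [j tij] := conj_transposition t i.
rewrite [H t *: (a i *: m)]scalerA (H_a tij) (algZZ _ (a j * H t)) -scalerA.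
by rewrite algZA -expr2 sqrr_sign algZ1 (a_const i j).
Qed.

(* The formula for [phi (H t *: m)] says that phi vanishes on the weight
   [dual rho]. *)
Lemma coordinate rho q (y : M) : dim_is (isotyp rho M) q ->
  weight rho y -> y != 0 ->
  exists phi : M -> k, [/\ {morph phi : u v / u + v},
    forall (c : k) m, phi (c%:A *: m) = c * phi m,
    forall t m, phi (H t *: m) = chi rho t * phi m & phi y = 1].
Proof.
move=> [b [bw bU]] wy y0.
have bc (c : 'rV[k]_q) : weight rho (\sum_i (c 0 i)%:A *: b i).
  apply: (big_ind (@weight rho M)); [exact: weight0|exact: weightD|].
  by move=> i _; apply/weightZ/isotypP.
have [e [ye _]] := bU y (introT (isotypP _ _) wy).
have [i0 ei0] : exists i, e 0 i != 0.
  apply: contrapT => e0; case/eqP: y0; rewrite ye big1 // => i _.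
  by have [->|ei] := eqVneq (e 0 i) 0; [rewrite algZ0|case: e0; exists i].
(* The graph of [phi]: the coordinate at [i0] of the weight [rho] part, divided by that of [y]. *)
pose R (m : M) d := exists u (c : 'rV[k]_q),
  [/\ weight (dual rho) u, m = u + \sum_i (c 0 i)%:A *: b i & d = c 0 i0 / e 0 i0].
(* Both the splitting into weights and the coordinates are unique, so [R] is functional. Each law of
   [phi] below then amounts to exhibiting one decomposition. *)
have RU m d d' : R m d -> R m d' -> d = d'.
  move=> [u [c [wu -> ->]]] [u' [c' [wu' E ->]]].
  have uu' : u - u' = \sum_i (c' 0 i)%:A *: b i - \sum_i (c 0 i)%:A *: b i.
    by apply/eqP; rewrite subr_eq addrC addrA eq_sym subr_eq eq_sym E addrC.
  have /eqP : u - u' = 0.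
    by apply: (@weight_disjoint rho); [rewrite uu'|]; apply: weightB.
  rewrite uu' subr_eq0 => /eqP cc'.
  have [s [_ sU]] := bU _ (introT (isotypP _ _) (bc c)).
  by rewrite -(sU c) // -(sU c').
have [phi phiP] : {phi : M -> k & forall m, R m (phi m)}.
  apply: choice => m; have [v [u [wv wu ->]]] := direct_weights rho dM m.
  have [c [-> _]] := bU v (introT (isotypP _ _) wv).
  by exists (c 0 i0 / e 0 i0), u, c; rewrite addrC.
exists phi; split.
- move=> u v; apply: (RU (u + v)) => //.
  have [u1 [c [wu1 -> ->]]] := phiP u; have [v1 [d [wv1 -> ->]]] := phiP v.
  exists (u1 + v1), (c + d); split; first exact: weightD.
    rewrite addrACA -big_split; congr (_ + _); apply: eq_bigr => i _.
    by rewrite mxE algZDl.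
  by rewrite mxE mulrDl.
- move=> c m; apply: (RU (c%:A *: m)) => //.
  have [u [d [wu -> ->]]] := phiP m; exists (c%:A *: u), (c *: d); split.
  + exact: weightZ.
  + rewrite scalerDr scaler_sumr; congr (_ + _); apply: eq_bigr => i _.
    by rewrite mxE algZA.
  + by rewrite mxE mulrA.
- move=> t m; apply: (RU (H t *: m)) => //.
  have [u [d [wu -> ->]]] := phiP m; exists (H t *: u), (chi rho t *: d); split.
  + by rewrite wu; apply: weightZ.
  + rewrite scalerDr bc scaler_sumr; congr (_ + _); apply: eq_bigr => i _.
    by rewrite mxE algZA.
  + by rewrite mxE mulrA.
- apply: (RU y) => //; exists 0, e; split; first exact: weight0.
    by rewrite add0r.
  by rewrite divff.
Qed.

End Typed.

(** * Modules spanned by one vector of each weight *)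

Lemma bigen_map rho e M N (x y : M) (x' y' : N) :
  [/\ weight rho x, weight (dual rho) y, x != 0 & y != 0] ->
  [/\ forall i, a i *: x = e%:A *: y, forall i, a i *: y = 0 &
      forall m, exists c d : k, m = c%:A *: x + d%:A *: y] ->
  weight rho x' -> weight (dual rho) y' ->
  (forall i, a i *: x' = e%:A *: y') -> (forall i, a i *: y' = 0) ->
  exists f : {linear M -> N}, f x = x' /\ f y = y'.
Proof.
move=> [wx wy x0 y0] [ax ay Mxy] wx' wy' ax' ay'.
have [p pP] : {p : M -> k * k & forall m, m = (p m).1%:A *: x + (p m).2%:A *: y}.
  apply: (@choice _ _ (fun m p => m = p.1%:A *: x + p.2%:A *: y)) => m.
  by have [c [d E]] := Mxy m; exists (c, d).
(* By [weight_free], any decomposition of [m] that can be written down computes [p m]. *)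
have pE m c d : m = c%:A *: x + d%:A *: y -> p m = (c, d).
  rewrite {1}(pP m) => /eqP; rewrite -subr_eq0 opprD addrACA -!algZN -!algZDl.
  move=> /eqP /(weight_free wx wy x0 y0) [/eqP + /eqP].
  by rewrite !subr_eq0 => /eqP <- /eqP <-; case: (p m).
have [u v|c m|t m|i m|f fE] :=
  @gen_linear M N (fun m => (p m).1%:A *: x' + (p m).2%:A *: y').
- rewrite (pE (u + v) ((p u).1 + (p v).1) ((p u).2 + (p v).2)) /=.
    by rewrite !algZDl addrACA.
  by rewrite !algZDl addrACA -!pP.
- rewrite (pE (c%:A *: m) (c * (p m).1) (c * (p m).2)) /=.
    by rewrite -!algZA scalerDr.
  by rewrite -!algZA -scalerDr -pP.
- rewrite (pE (H t *: m) ((p m).1 * chi rho t) ((p m).2 * chi (dual rho) t)) /=.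
    by rewrite scalerDr !algZC wx' wy' !algZA.
  by rewrite {1}(pP m) scalerDr !algZC wx wy !algZA.
- rewrite (pE (a i *: m) 0 ((p m).1 * e)) /=.
    by rewrite scalerDr !algZC ax' ay' scaler0 algZ0 addr0 add0r algZA.
  by rewrite {1}(pP m) scalerDr !algZC ax ay scaler0 algZ0 addr0 add0r algZA.
exists f; rewrite !fE (pE x 1 0) ?(pE y 0 1) /=;
  by rewrite ?algZ1 ?algZ0 ?addr0 ?add0r.
Qed.

Lemma bigen_unique rho e M N : bigen rho e M -> bigen rho e N -> mod_iso M N.
Proof.
move=> [x [y [P Q]]] [x' [y' [P' Q']]].
have [[wx wy _ _] [ax ay Mxy]] := (P, Q).
have [[wx' wy' _ _] [ax' ay' Nxy]] := (P', Q').
have [f [fx fy]] := bigen_map P Q wx' wy' ax' ay'.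
have [g [gx gy]] := bigen_map P' Q' wx wy ax ay.
exists f, g => m; [have [c [d ->]] := Mxy m|have [c [d ->]] := Nxy m];
  by rewrite !linearD !linearZZ ?fx ?fy ?gx ?gy ?fx ?fy.
Qed.

Lemma bigen_indecomposable rho M : bigen rho 1 M -> indecomposable_mod M.
Proof.
move=> [x [y [[wx wy x0 y0] [ax ay Mxy]]]]; split; first by exists x.
have [i _] := transposition_exists n_ge2.
(* The line of y is contained in every nonzero submodule. *)
have yU (U : {pred M}) m : submod_closed U -> m \in U -> m != 0 -> y \in U.
  move=> Us mU m0; have [c [d E]] := Mxy m.
  suff [h [l [l0 hm]]] : exists h l, l != 0 /\ h *: m = (l : k)%:A *: y.
    by rewrite -[y]algZ1 -(mulVf l0) -algZA -hm !submod_scale.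
  (* If [c] is nonzero, [a i] sends [m] to [c y]; otherwise [m] is itself a multiple of [y]. *)
  have [c0|c0] := eqVneq c 0; last first.
    by exists (a i), c; rewrite E scalerDr !algZC ax ay scaler0 addr0 algZ1.
  exists 1, d; rewrite scale1r E c0 algZ0 add0r; split=> //.
  by apply: contraNneq m0 => d0; rewrite E c0 d0 !algZ0 addr0.
move=> U V Us Vs [_ UV].
have [|[u uU u0]] := submod_nonzero Us; first by left.
have [|[v vV v0]] := submod_nonzero Vs; first by right.
by have /eqP := UV _ (yU _ _ Us uU u0) (yU _ _ Vs vV v0); rewrite (negPf y0).
Qed.

(** The line of [y] is a nonzero submodule, and it misses [x], which has the other weight. *)
Lemma bigen_not_simple rho e M : bigen rho e M -> ~ simple_mod M.
Proof.
move=> [x [y [[wx wy x0 y0] [ax ay Mxy]]]] [_ /(_ _ (line_submod wy ay))].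
case=> [/(_ y)|/(_ x)]; rewrite !inE ?(negPf y0).
  by move=> /asboolP; apply; exists 1; rewrite algZ1.
move=> /asboolP[c E]; case/eqP: x0; apply: (weight_disjoint wx).
by rewrite E; apply: weightZ.
Qed.

(** For a weight vector, the component along the basis vector of the other weight has both weights,
    so it is 0. *)
Lemma bigen_weight rho e M : bigen rho e M -> exists x y : M,
  [/\ weight rho x, weight (dual rho) y, x != 0 & y != 0] /\
  [/\ forall i, a i *: x = e%:A *: y, forall i, a i *: y = 0,
      forall m, weight rho m -> exists c : k, m = c%:A *: x,
      forall m, weight (dual rho) m -> exists c : k, m = c%:A *: y &
      forall m, exists c d : k, m = c%:A *: x + d%:A *: y].
Proof.
move=> [x [y [[wx wy x0 y0] [ax ay Mxy]]]]; exists x, y; split=> //.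
split=> // m wm; have [c [d E]] := Mxy m.
  exists c; suff d0 : d%:A *: y = 0 by rewrite E d0 addr0.
  apply: (@weight_disjoint rho); last exact: weightZ.
  have -> : d%:A *: y = m - c%:A *: x by rewrite E addrC addKr.
  exact/weightB/weightZ.
exists d; suff c0 : c%:A *: x = 0 by rewrite E c0 add0r.
apply: (weight_disjoint (weightZ _ wx)).
have -> : c%:A *: x = m - d%:A *: y by rewrite E addrK.
exact/weightB/weightZ.
Qed.

(** The second half turns given dimensions [p] and [q] into 1, as [dim_is] does not assert by itself
    that a dimension is unique. *)
Lemma bigen_dim rho e M mu : bigen rho e M -> dim_is (isotyp mu M) 1 /\
  forall p, dim_is (isotyp mu M) p -> p = 1%N.
Proof.
move=> /bigen_weight[x [y [[wx wy x0 y0] [_ _ Mx My _]]]].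
have M0 : 0 \in isotyp mu M by apply/isotypP/weight0.
have [z [zM z0 Mz]] : exists z, [/\ z \in isotyp mu M, z != 0 &
    forall m, m \in isotyp mu M -> exists c : k, m = c%:A *: z].
  case: mu M0 => _; case: rho wx wy Mx My => /= wx wy Mx My;
    [exists x|exists y|exists y|exists x];
    by split=> // [|m /isotypP]; [apply/isotypP|auto].
split; first exact: dim_is1 zM z0 Mz.
by move=> p; apply: dim_is_gen M0 zM z0 Mz.
Qed.

Lemma bigen_direct rho e M : bigen rho e M ->
  direct_sum (isotyp Eps M) (isotyp Sgn M).
Proof.
move=> [x [y [[wx wy x0 y0] [_ _ Mxy]]]]; split=> [m|m /isotypP w /isotypP w'].
  have [c [d ->]] := Mxy m.
  case: rho wx wy => /= wx wy; [|rewrite addrC];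
    by do 2!eexists; split; last reflexivity; apply/isotypP/weightZ.
exact: (weight_disjoint (rho := Eps)).
Qed.

(** In a module of the second kind the [a i] kill weight [rho], whereas in the first they send [x]
    to the nonzero [y]. *)
Lemma bigen_dual rho e M : bigen rho 1 M -> ~ bigen (dual rho) e M.
Proof.
move=> [x [y [[wx _ _ y0] [ax _ _]]]] /bigen_weight[x' [y' [_ [_ ay' _ My' _]]]].
have [i _] := transposition_exists n_ge2.
rewrite dualK in My'; have [c E] := My' x wx.
by case/eqP: y0; rewrite -[y]algZ1 -(ax i) E algZC ay' scaler0.
Qed.

Lemma bigen_nonzero rho mu M : bigen rho 1 M -> ~ bigen mu 0 M.
Proof.
move=> [x [y [[wx _ _ y0] [ax _ _]]]] [x' [y' [_ [ax' ay' Mxy]]]].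
have [i _] := transposition_exists n_ge2; have [c [d E]] := Mxy x.
case/eqP: y0; rewrite -[y]algZ1 -(ax i) E scalerDr !algZC ax' ay'.
by rewrite algZ0 !scaler0 addr0.
Qed.

(** * Decomposing modules of the given type *)

Lemma dim1_cases M : direct_sum (isotyp Eps M) (isotyp Sgn M) ->
  dim_is (isotyp Eps M) 1 -> dim_is (isotyp Sgn M) 1 ->
  [\/ bigen Eps 1 M, bigen Sgn 1 M | bigen Eps 0 M].
Proof.
move=> dM /dim_is1_gen[x [/isotypP wx x0 Mx]] /dim_is1_gen[y [/isotypP wy y0 My]].
have Mxy m : exists c d : k, m = c%:A *: x + d%:A *: y.
  have [u [v [uM vM ->]]] := dM.1 m.
  by have [c ->] := Mx u uM; have [d ->] := My v vM; exists c, d.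
have [i _] := transposition_exists n_ge2.
(* The [a_i] send [x] to [c y] and [y] to [d x]. When [c] or [d] is nonzero, taking [a i *: x] or
   [a i *: y] as the second vector makes the constant 1, and [a_a] shows that this vector is
   killed. *)
have [c ax] := My _ (introT (isotypP _ _) (weight_a dM i wx)).
have [d ay] := Mx _ (introT (isotypP _ _) (weight_a dM i wy)).
have ai j m : a j *: m = a i *: m := a_const dM j i m.
have [c0|c0] := eqVneq c 0; last first.
  constructor 1; exists x, (a i *: x); split; split=> //.
  - exact: (weight_a dM).
  - by rewrite ax algZ_eq0 negb_or c0.
  - by move=> j; rewrite algZ1.
  - by move=> j; apply: a_a.
  - move=> m; have [b [e ->]] := Mxy m; exists b, (e / c).
    by rewrite ax algZA divfK.
have [d0|d0] := eqVneq d 0; last first.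
  constructor 2; exists y, (a i *: y); split; split=> //.
  - exact: (weight_a dM).
  - by rewrite ay algZ_eq0 negb_or d0.
  - by move=> j; rewrite algZ1.
  - by move=> j; apply: a_a.
  - move=> m; have [b [e ->]] := Mxy m; exists e, (b / d).
    by rewrite ay algZA divfK // addrC.
constructor 3; exists x, y; split; split=> // j; rewrite ai ?ax ?ay ?c0 ?d0 //.
by rewrite algZ0.
Qed.

Lemma indecomposable_cases M p q :
  direct_sum (isotyp Eps M) (isotyp Sgn M) ->
  dim_is (isotyp Eps M) p -> dim_is (isotyp Sgn M) q ->
  indecomposable_mod M -> exists rho, line rho M \/ bigen rho 1 M.
Proof.
move=> dM dimE dimS [[m0 m0_neq0] Mi].
have dims rho : exists r, dim_is (isotyp rho M) r by case: rho; [exists p|exists q].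
have [i _] := transposition_exists n_ge2.
have ai j m : a j *: m = a i *: m := a_const dM j i m.
have [|a0] := EM (exists rho (x : M), weight rho x /\ a i *: x != 0).
  move=> [rho [x [wx y0]]]; exists rho; right.
  move: y0; set y := a i *: x => y0.
  have wy : weight (dual rho) y by apply: weight_a.
  have [r dimr] := dims (dual rho).
  have [phi [phiD phiZ phiH phiy]] := coordinate dM dimr wy y0.
  have phi0 : phi 0 = 0 by rewrite -(algZ0 x) phiZ mul0r.
  (* [x] has weight [rho] while [phi] transforms by [dual rho]: a transposition yields two opposite
     values. *)
  have phix : phi x = 0.
    have := phiH (val i) x; rewrite wx phiZ char_val_dual_transposition mulNr.
    move/eqP; rewrite -subr_eq0 opprK -mulr2n -mulr_natr !mulf_eq0.
    by rewrite (negPf two_neq0) (negPf (char_val_neq0 _ _ _)) orbF => /eqP.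
  have ay j : a j *: y = 0 by apply: a_a.
  pose U := [pred m | `[< exists c d : k, m = c%:A *: x + d%:A *: y >]].
  pose W := [pred m | (phi m == 0) && (phi (a i *: m) == 0)].
  have Us : submod_closed U.
    apply: gen_submod.
    - by apply/asboolP; exists 0, 0; rewrite !algZ0 addr0.
    - move=> u v /asboolP[c [d ->]] /asboolP[c' [d' ->]]; apply/asboolP.
      by exists (c + c'), (d + d'); rewrite !algZDl addrACA.
    - move=> e u /asboolP[c [d ->]]; apply/asboolP.
      by exists (e * c), (e * d); rewrite scalerDr !algZA.
    - move=> t u /asboolP[c [d ->]]; apply/asboolP.
      exists (c * chi rho t), (d * chi (dual rho) t).
      by rewrite scalerDr !algZC wx wy !algZA.
    - move=> j u /asboolP[c [d ->]]; apply/asboolP; exists 0, c.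
      by rewrite scalerDr !algZC ay ai scaler0 algZ0 addr0 add0r.
  (* Stability under [H t] comes from [a_H], stability under [a j] from [a_const] and [a_a]. *)
  have Ws : submod_closed W.
    apply: gen_submod; rewrite ?inE.
    - by rewrite scaler0 phi0 eqxx.
    - move=> u v /andP[/eqP u1 /eqP u2] /andP[/eqP v1 /eqP v2].
      by rewrite inE scalerDr !phiD u1 u2 v1 v2 addr0 eqxx.
    - move=> c u /andP[/eqP u1 /eqP u2].
      by rewrite inE algZC !phiZ u1 u2 mulr0 eqxx.
    - move=> t u /andP[/eqP u1 /eqP u2].
      by rewrite inE (a_H dM) phiZ !phiH u1 u2 !mulr0 eqxx.
    - move=> j u /andP[/eqP u1 /eqP u2].
      by rewrite inE ai u2 a_a // phi0 eqxx.
  (* These are the coordinates of the projection onto [U]: [phi] is 0 on [x] and 1 on [y], and [a i]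
     sends [x] to [y] and [y] to 0. *)
  have wP m : m - ((phi (a i *: m))%:A *: x + (phi m)%:A *: y) \in W.
    have phiB u v : phi (u - v) = phi u - phi v.
      by rewrite phiD -[v in - v]algZ1 -algZN phiZ mulN1r.
    rewrite inE phiB phiD !phiZ phix phiy mulr0 mulr1 add0r subrr eqxx.
    rewrite scalerBr scalerDr !algZC ay scaler0 addr0 phiB phiZ phiy mulr1.
    by rewrite subrr eqxx.
  (* [U] contains [y], so [W] is the summand that vanishes and [x], [y] span [M]. *)
  have [|/(_ y)|W0] := Mi U W Us Ws.
  - split=> [m|m /asboolP[c [d ->]] /andP[]].
      exists ((phi (a i *: m))%:A *: x + (phi m)%:A *: y).
      exists (m - ((phi (a i *: m))%:A *: x + (phi m)%:A *: y)).
      split=> //; last by rewrite addrC subrK.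
      by apply/asboolP; do 2!eexists.
    rewrite phiD !phiZ phix phiy mulr0 add0r mulr1 => /eqP ->.
    rewrite algZ0 addr0 algZC phiZ phiy mulr1 => /eqP ->.
    by rewrite algZ0.
  - rewrite !inE (negPf y0) => /asboolP; case.
    by exists 0, 1; rewrite algZ0 algZ1 add0r.
  - exists x, y; split; split=> //.
    + by apply: contraNneq y0 => x0; rewrite /y x0 scaler0.
    + by move=> j; rewrite ai algZ1.
    + move=> m; have := wP m; rewrite W0 inE subr_eq0 => /eqP ->.
      by do 2!eexists.
have {}a0 j (m : M) : a j *: m = 0.
  have [u [v [wu wv ->]]] := direct_weights Eps dM m.
  rewrite ai scalerDr.
  suff a0' rho (w : M) : weight rho w -> a i *: w = 0.
    by rewrite (a0' _ _ wu) (a0' _ _ wv) addr0.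
  by move=> ww; apply/eqP; apply: contrapT => /negP aw; apply: a0; exists rho, w.
have [rho [y [wy y0]]] : exists rho (y : M), weight rho y /\ y != 0.
  have [u [v [wu wv E]]] := direct_weights Eps dM m0.
  have [u0|u0] := eqVneq u 0; last by exists Eps, u.
  by exists Sgn, v; split=> //; move: m0_neq0; rewrite E u0 add0r.
exists rho; left; have [r dimr] := dims rho.
have [phi [phiD phiZ phiH phiy]] := coordinate dM dimr wy y0.
have phi0 : phi 0 = 0 by rewrite -(algZ0 y) phiZ mul0r.
have ay j : a j *: y = 0 by [].
(* With every [a j] acting by 0, the kernel of [phi] alone is a submodule complementing the line of
   [y]. *)
pose W := [pred m | phi m == 0].
have Ws : submod_closed W.
  apply: gen_submod; rewrite ?inE ?phi0 //.
  - by move=> u v; rewrite !inE phiD => /eqP -> /eqP ->; rewrite addr0.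
  - by move=> c u; rewrite !inE phiZ => /eqP ->; rewrite mulr0.
  - by move=> t u; rewrite !inE phiH => /eqP ->; rewrite mulr0.
  - by move=> j u; rewrite !inE a0 phi0.
have wP m : m - (phi m)%:A *: y \in W.
  by rewrite inE -algZN phiD phiZ phiy mulr1 subrr.
have [|/(_ y)|W0] := Mi _ W (line_submod wy ay) Ws.
- split=> [m|m /asboolP[c ->]]; last first.
    by rewrite inE phiZ phiy mulr1 => /eqP ->; rewrite algZ0.
  exists ((phi m)%:A *: y), (m - (phi m)%:A *: y).
  by split=> //; [apply/asboolP; eexists|rewrite addrC subrK].
- rewrite !inE (negPf y0) => /asboolP; case.
  by exists 1; rewrite algZ1.
- exists y; split=> // m; have := wP m; rewrite W0 inE subr_eq0 => /eqP ->.
  by eexists.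
Qed.

(** * Extensions of one line by the other *)

Lemma bigen_short_exact rho M (S S' : lmodType A) : bigen rho 1 M -> line rho S ->
  line (dual rho) S' ->
  exists (f : {linear S' -> M}) (g : {linear M -> S}), short_exact f g.
Proof.
move=> [x [y [P Q]]] [s [ws as0 s0 Ss]] [s' [ws' as'0 s'0 Ss']].
have [[wx wy x0 y0] [ax ay Mxy]] := (P, Q).
have [f fs'] := line_map ws' as'0 s'0 Ss' wy ay.
(* The projection sends [x] to [s] and [y] to 0. *)
have [||g [gx gy]] := bigen_map P Q ws (weight0 _ _).
- by move=> i; rewrite scaler0.
- by move=> i; rewrite scaler0.
exists f, g; split.
- move=> u v; have [c ->] := Ss' u; have [d ->] := Ss' v.
  by rewrite !linearZZ fs' => /(algZIl y0) ->.
- by move=> z; have [c ->] := Ss z; exists (c%:A *: x); rewrite linearZZ gx.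
- move=> m; split=> [|[z <-]]; last first.
    by have [c ->] := Ss' z; rewrite !linearZZ fs' gy scaler0.
  have [c [d ->]] := Mxy m; rewrite linearD !linearZZ gx gy scaler0 addr0.
  move=> /eqP; rewrite algZ_eq0 (negPf s0) orbF => /eqP ->.
  by exists (d%:A *: s'); rewrite linearZZ fs' algZ0 add0r.
Qed.

Lemma bigen_of_short_exact rho M (S S' : lmodType A)
    (f : {linear S' -> M}) (g : {linear M -> S}) :
  (n`!%:R : k) != 0 -> (forall t s, H t * H s = H (t * s)%g) ->
  line rho S -> line (dual rho) S' -> short_exact f g ->
  indecomposable_mod M -> bigen rho 1 M.
Proof.
move=> fact_neq0 HM [s [ws as0 s0 Ss]] [s' [ws' as'0 s'0 Ss']].
move=> [f_inj g_surj ker_g] [_ Mi].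
set y := f s'; have wy : weight (dual rho) y by apply: weight_linear.
have y0 : y != 0 by rewrite -(linear0 f) (inj_eq f_inj).
have ay i : a i *: y = 0 by rewrite -linearZZ as'0 linear0.
have gy : g y = 0 by apply/ker_g; exists s'.
have ker_y m : g m = 0 -> exists c : k, m = c%:A *: y.
  by move=> /ker_g[z <-]; have [c ->] := Ss' z; exists c; rewrite linearZZ.
have [x' gx'] := g_surj s.
(* As chi is its own inverse, this is n! times the projection of x' onto weight
   rho. *)
pose x := \sum_t (chi rho t)%:A *: (H t *: x').
have wx : weight rho x.
  move=> t; rewrite /x [in RHS](reindex_inj (mulgI t)) !scaler_sumr.
  apply: eq_bigr => r _; rewrite algZC scalerA HM algZA char_valM mulrA.
  by rewrite char_val_sq mul1r.
have gx : g x = (n`!%:R : k)%:A *: s.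
  rewrite linear_sum (eq_bigr (fun=> s)) => [|t _]; last first.
    by rewrite !linearZZ gx' ws algZA char_val_sq algZ1.
  rewrite sumr_const (eq_card (B := predT)) // card_Sn.
  by rewrite [_ *: 1]scaler_nat scaler_nat.
have x0 : x != 0.
  apply: contra_neqN fact_neq0 => /eqP x0; move/eqP: gx.
  by rewrite x0 linear0 eq_sym algZ_eq0 (negPf s0) orbF => /eqP.
have Mxy m : exists c d : k, m = c%:A *: x + d%:A *: y.
  have [c gm] := Ss (g m).
  have [|d E] := ker_y (m - (c / n`!%:R)%:A *: x).
    by rewrite linearB linearZZ gx algZA divfK // gm subrr.
  by exists (c / n`!%:R), d; rewrite -E addrC subrK.
(* The [a i] act by 0 on the quotient, so [a i *: x] falls into the line of [y]; this provides the
   weight that [weight_a_const] asks for. *)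
have axy i : exists c : k, a i *: x = c%:A *: y.
  by apply: ker_y; rewrite linearZZ gx algZC as0 scaler0.
have [i _] := transposition_exists n_ge2; have [c ac] := axy i.
have {axy}ax j : a j *: x = c%:A *: y.
  rewrite -ac; apply: (weight_a_const j i wx) => l.
  by have [d ->] := axy l; apply: weightZ.
have [c0|c0] := eqVneq c 0; last first.
  exists x, (c%:A *: y); split; split=> //.
  - exact: weightZ.
  - by rewrite algZ_eq0 negb_or c0.
  - by move=> j; rewrite algZ1.
  - by move=> j; rewrite algZC ay scaler0.
  - move=> m; have [b [d ->]] := Mxy m; exists b, (d / c).
    by rewrite algZA divfK.
have ax0 j : a j *: x = 0 by rewrite ax c0 algZ0.
(* With [c = 0] the lines of [x] and [y] would decompose [M]. *)
have [|/(_ x)|/(_ y)] := Mi _ _ (line_submod wx ax0) (line_submod wy ay).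
- split=> [m|m /asboolP[b ->] /asboolP[d E]].
    have [b [d ->]] := Mxy m; exists (b%:A *: x), (d%:A *: y).
    by split=> //; apply/asboolP; eexists.
  by apply: (weight_disjoint (weightZ _ wx)); rewrite E; apply: weightZ.
- rewrite !inE (negPf x0) => /asboolP; case.
  by exists 1; rewrite algZ1.
- rewrite !inE (negPf y0) => /asboolP; case.
  by exists 1; rewrite algZ1.
Qed.

(** * Concrete models *)

Lemma product_bigen rho (S T : lmodType A) :
  line rho S -> line (dual rho) T -> bigen rho 0 (S * T)%type.
Proof.
move=> [s [ws as0 s0 Ss]] [t [wt at0 t0 Tt]].
exists (s, 0), (0, t); split; split.
- by move=> r; congr (_, _); rewrite /= ?ws ?scaler0.
- by move=> r; congr (_, _); rewrite /= ?wt ?scaler0.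
- by apply: contraNneq s0 => -[->].
- by apply: contraNneq t0 => -[->].
- by move=> i; rewrite algZ0; congr (_, _); rewrite /= ?as0 ?scaler0.
- by move=> i; congr (_, _); rewrite /= ?at0 ?scaler0.
- move=> [u v]; have [c ->] := Ss u; have [d ->] := Tt v; exists c, d.
  by congr (_, _); rewrite /= scaler0 ?addr0 ?add0r.
Qed.

Lemma restr_line rho (phi : {rmorphism A -> k^o}) :
  (forall c : k, phi c%:A = c) -> (forall t, phi (H t) = chi rho t) ->
  (forall i, phi (a i) = 0) -> line rho (restr phi k^o).
Proof.
move=> phiZ phiH phia.
have Z (h : A) (s : restr phi k^o) : h *: s = (phi h * (s : k^o) : k^o) by [].
exists (1 : k^o); split.
- by move=> t; rewrite !Z phiZ phiH.
- by move=> i; rewrite Z phia mul0r.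
- exact: oner_neq0.
- by move=> m; exists (m : k^o); rewrite Z phiZ mulr1.
Qed.

(** The standard columns are weight vectors, and [delta_mx 1 0] sends the first to the second and
    the second to 0. *)
Lemma restr_bigen rho (phi : {rmorphism A -> 'M[k]_2}) :
  (forall c : k, phi c%:A = c%:M) ->
  (forall t, phi (H t) = ext_diag k rho t) ->
  (forall i, phi (a i) = delta_mx 1 0) -> bigen rho 1 (restr phi (colmod k 1)).
Proof.
move=> phiZ phiH phia.
have Z (h : A) (v : restr phi (colmod k 1)) : h *: v = (phi h *m (v : 'cV_2) : 'cV_2).
  by [].
have D t i : ext_diag k rho t *m delta_mx i 0 =
    (if i == 0 then chi rho t else chi (dual rho) t) *: (delta_mx i 0 : 'cV[k]_2).
  apply/colP => j; rewrite mul_diag_mx !mxE andbT.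
  by have [->|_] := eqVneq j i; rewrite ?mulr0.
have d0 i : (delta_mx i 0 : 'cV[k]_2) != 0.
  by apply/eqP => /colP/(_ i)/eqP; rewrite !mxE !eqxx oner_eq0.
exists (delta_mx 0 0 : 'cV[k]_2), (delta_mx 1 0 : 'cV[k]_2); split; split=> //.
- by move=> t; rewrite !Z phiH phiZ D mul_scalar_mx.
- by move=> t; rewrite !Z phiH phiZ D mul_scalar_mx.
- by move=> i; rewrite !Z phia phiZ mul_delta_mx mul1mx.
- by move=> i; rewrite !Z phia mul_delta_mx_0.
- move=> m; exists ((m : 'cV[k]_2) 0 0), ((m : 'cV[k]_2) 1 0).
  rewrite !Z !phiZ !mul_scalar_mx; apply/colP => i.
  rewrite !mxE !andbT; case: i => [[|[|//]] i2].
    by rewrite mulr1 mulr0 addr0; congr (_ _ _); apply: val_inj.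
  by rewrite mulr1 mulr0 add0r; congr (_ _ _); apply: val_inj.
Qed.

End Char2.
End Modules.

(** * The modules M_{rho, dual rho} *)

Section ExtensionModule.
Variables (k : fieldType) (n : nat) (La Ga : k) (rho : lin_char).
Local Notation X := ('S_n + transposition n)%type.

(** All transpositions receive the same matrix of square 0, as [a_const] and [a_a] force. *)
Definition ext_fun (x : X) : 'M[k]_2 :=
  match x with inl t => ext_diag k rho t | inr _ => delta_mx 1 0 end.

Lemma ext_diagM (t s : 'S_n) :
  ext_diag k rho t * ext_diag k rho s = ext_diag k rho (t * s)%g.
Proof.
rewrite -mulmxE mulmx_diag; congr diag_mx; apply/rowP => i.
by rewrite !mxE !char_valM; case: eqP.
Qed.

Lemma ext_diag1 : ext_diag k rho (1%g : 'S_n) = 1.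
Proof.
by apply/matrixP => i j; rewrite !mxE !char_val1; case: (i == 0).
Qed.

(** Hence [1 - H_i H_j] acts by 0, and the right-hand sides with [La] and [Ga] vanish. *)
Lemma ext_diag_transposition (i j : transposition n) :
  ext_diag k rho (val i) * ext_diag k rho (val j) = 1.
Proof.
rewrite -mulmxE mulmx_diag; apply/matrixP => r s; rewrite !mxE.
by case: (r == 0); case: (s == 0); rewrite !char_val_transposition.
Qed.

Lemma delta10_sq : (delta_mx 1 0 : 'M[k]_2) * delta_mx 1 0 = 0.
Proof. exact: mul_delta_mx_0. Qed.

Lemma ext_fun_rel x : HQ_rel La Ga x -> free_eval ext_fun x = 0.
Proof.
apply: HQ_rel_eval => /= [|t s|t i j _|i|i j _ _|i j l _ _].
- exact: ext_diag1.
- exact: ext_diagM.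
(* The only nonzero entry is (1, 0), where the relation reads [char_val_dual]. *)
- apply/matrixP => r s; rewrite -!mulmxE mul_diag_mx mul_mx_diag !mxE char_val_dual.
  case: r s => [[|[|//]] r2] [[|[|//]] s2] //=; rewrite ?mulr0 ?mul0r ?mulr0 //.
  by rewrite mul1r mulr1.
- exact: delta10_sq.
- by rewrite ext_diag_transposition subrr scaler0 delta10_sq addr0.
- by rewrite ext_diag_transposition subrr scaler0 delta10_sq !addr0.
Qed.

Definition ext_lift : HQ n La Ga -> 'M[k]_2 :=
  presented_lift (r := HQ_rel La Ga) ext_fun.

HB.instance Definition _ := GRing.isZmodMorphism.Build
  (HQ n La Ga) 'M[k]_2 ext_lift (presented_lift_zmod_morphism ext_fun_rel).
HB.instance Definition _ := GRing.isMonoidMorphism.Build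
  (HQ n La Ga) 'M[k]_2 ext_lift (presented_lift_monoid_morphism ext_fun_rel).

Lemma ext_liftZ (c : k) : ext_lift c%:A = c%:M.
Proof.
rewrite /ext_lift (presented_lift_scalable ext_fun_rel).
by rewrite (presented_lift_monoid_morphism ext_fun_rel).1 scalemx1.
Qed.

Lemma ext_lift_H t : ext_lift (HQ_H La Ga t) = ext_diag k rho t.
Proof. by rewrite /ext_lift /HQ_H (presented_liftE ext_fun_rel) free_eval_gen. Qed.

Lemma ext_lift_a i : ext_lift (HQ_a La Ga i) = delta_mx 1 0.
Proof. by rewrite /ext_lift /HQ_a (presented_liftE ext_fun_rel) free_eval_gen. Qed.

Definition ext_mod : lmodType (HQ n La Ga) := restr ext_lift (colmod k 1).

Lemma ext_mod_bigen : bigen (@HQ_H k n La Ga) (@HQ_a k n La Ga) rho 1 ext_mod.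
Proof.
exact: (restr_bigen (phi := ext_lift) ext_liftZ ext_lift_H ext_lift_a).
Qed.

Lemma S_mod_line : line (@HQ_H k n La Ga) (@HQ_a k n La Ga) rho (S_mod rho).
Proof.
apply: (restr_line (phi := S_lift rho)); [|exact: S_lift_H|exact: S_lift_a].
move=> c; rewrite /= /S_lift (presented_lift_scalable (@S_fun_rel k n La Ga rho)).
rewrite (presented_lift_monoid_morphism (@S_fun_rel k n La Ga rho)).1.
exact: mulr1.
Qed.

End ExtensionModule.

(** * Classification *)

Section Classification.
Variables (k : fieldType) (n : nat) (La Ga : k).
Hypotheses (two_neq0 : (2%:R : k) != 0) (n_ge2 : (2 <= n)%N).
Local Notation A := (HQ n La Ga).
Local Notation line := (line (@HQ_H k n La Ga) (@HQ_a k n La Ga)).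
Local Notation bigen := (bigen (@HQ_H k n La Ga) (@HQ_a k n La Ga)).
Local Notation S := (@S_mod k n La Ga).
Local Notation E := (@ext_mod k n La Ga).
Implicit Types (M : lmodType A) (rho : lin_char).
Let gen_ind := @HQ_scalar_ind k n La Ga.
Let H_a := @HQ_Ha k n La Ga.
Let aa0 := @HQ_aa k n La Ga.

Lemma lineP rho M : line rho M <-> mod_iso M (S rho).
Proof.
have SL := S_mod_line n La Ga rho.
split=> [ML|/mod_iso_sym iso]; first exact: (line_unique gen_ind ML SL).
exact: line_iso iso SL.
Qed.

Lemma bigenP rho M : bigen rho 1 M <-> mod_iso M (E rho).
Proof.
have EB := ext_mod_bigen n La Ga rho.
split=> [MB|/mod_iso_sym iso]; last exact: bigen_iso iso EB.
exact: (bigen_unique gen_ind two_neq0 n_ge2 MB EB).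
Qed.

Lemma bigen0P M : bigen Eps 0 M <-> mod_iso M (S Eps * S Sgn)%type.
Proof.
have SB := product_bigen (S_mod_line n La Ga Eps)
  (S_mod_line n La Ga Sgn : line (dual Eps) _).
split=> [MB|/mod_iso_sym iso]; last exact: bigen_iso iso SB.
exact: (bigen_unique gen_ind two_neq0 n_ge2 MB SB).
Qed.

Lemma bigen_eps_sgn_type rho e M : bigen rho e M -> eps_sgn_type M 1 1.
Proof.
move=> MB; split; first exact: (bigen_direct two_neq0 n_ge2 MB).
  exact: (bigen_dim two_neq0 n_ge2 Eps MB).1.
exact: (bigen_dim two_neq0 n_ge2 Sgn MB).1.
Qed.

Lemma eps_sgn_cases M p q : eps_sgn_type M p q -> indecomposable_mod M ->
  exists rho, line rho M \/ bigen rho 1 M.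
Proof.
move=> [dM dE dS].
exact: (indecomposable_cases gen_ind H_a aa0 two_neq0 n_ge2 dM dE dS).
Qed.

(** A simple module is indecomposable, hence a line or a [bigen rho 1], and the latter is not
    simple. *)
Lemma eps_sgn_simple M p q : eps_sgn_type M p q ->
  (simple_mod M <-> mod_iso M (S Eps) \/ mod_iso M (S Sgn)).
Proof.
move=> tM; split=> [sM|].
  have [rho [/lineP|MB]] := eps_sgn_cases tM (simple_indecomposable sM).
    by case: rho; [left|right].
  by case: (bigen_not_simple gen_ind two_neq0 n_ge2 MB).
by case=> /lineP; apply: line_simple.
Qed.

(** The case [p = q = 1] includes the direct sum of S_Eps and S_Sgn, which has to be excluded; by
    [dim1_cases] it is the only decomposable one. *)
Lemma eps_sgn_indecomposable M p q : eps_sgn_type M p q ->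
  (indecomposable_mod M <-> simple_mod M \/
     [/\ p = 1%N, q = 1%N & ~ mod_iso M (S Eps * S Sgn)%type]).
Proof.
move=> tM; split=> [iM|[/simple_indecomposable //|[p1 q1 nM]]].
  have [rho [ML|MB]] := eps_sgn_cases tM iM; first by left; apply: line_simple ML.
  case: tM => _ dE dS; right; split.
  - exact: (bigen_dim two_neq0 n_ge2 Eps MB).2 dE.
  - exact: (bigen_dim two_neq0 n_ge2 Sgn MB).2 dS.
  - by move=> /bigen0P; apply: (bigen_nonzero n_ge2 MB).
move: tM; rewrite p1 q1 => -[dM dE dS].
have [MB|MB|/bigen0P/nM []] := dim1_cases H_a aa0 two_neq0 n_ge2 dM dE dS;
  exact: (bigen_indecomposable n_ge2 MB).
Qed.

(** Uniqueness holds because every indecomposable extension satisfies [bigen rho 1], which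
    determines the isomorphism class. *)
Lemma ext_mod_is_M rho : (n`!%:R : k) != 0 -> is_M rho (dual rho) (E rho).
Proof.
move=> fact0; have EB := ext_mod_bigen n La Ga rho; split.
  split; first exact: (bigen_indecomposable n_ge2 EB).
  by apply: (bigen_short_exact gen_ind two_neq0 n_ge2 EB); apply: S_mod_line.
move=> N [iN [f [g fg]]]; apply/bigenP.
apply: (bigen_of_short_exact gen_ind H_a two_neq0 n_ge2 fact0 _ _ _ fg iN).
- exact: HQ_HM.
- exact: S_mod_line.
- exact: S_mod_line.
Qed.

Lemma eps_sgn_indecomposable1 M : eps_sgn_type M 1 1 ->
  (indecomposable_mod M <-> mod_iso M (E Eps) \/ mod_iso M (E Sgn)).
Proof.
move=> [dM dE dS]; split=> [iM|].
  have [/bigenP|/bigenP|/bigen0P MB] := dim1_cases H_a aa0 two_neq0 n_ge2 dM dE dS;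
    [by left|by right|].
  have tM : eps_sgn_type M 1 1 by split.
  have [/(eps_sgn_simple tM) sM|[_ _ //]] := (eps_sgn_indecomposable tM).1 iM.
  move/bigen0P in MB.
  case: (bigen_not_simple gen_ind two_neq0 n_ge2 MB).
  exact/(eps_sgn_simple tM).
by case=> /bigenP MB; apply: (bigen_indecomposable n_ge2 MB).
Qed.

Lemma ext_mod_not_iso : ~ mod_iso (E Eps) (E Sgn).
Proof.
move/bigenP; apply: (@bigen_dual _ _ _ _ _ two_neq0 n_ge2 Eps 1 (E Eps)).
exact: ext_mod_bigen.
Qed.

End Classification.

Theorem proposition3p12 (k : closedFieldType) (k_char0 : [pchar k] =i pred0)
    (n : nat) (n_ge3 : (3 <= n)%N) (La Ga : k) :
  (forall (M : lmodType (HQ n La Ga)) (p q : nat), eps_sgn_type M p q ->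
     (simple_mod M <-> mod_iso M (S_mod Eps) \/ mod_iso M (S_mod Sgn)) /\
     (indecomposable_mod M <->
        simple_mod M \/
        [/\ p = 1%N, q = 1%N
          & ~ mod_iso M (@S_mod k n La Ga Eps * @S_mod k n La Ga Sgn)%type])) /\
  (exists M_eps_sgn M_sgn_eps : lmodType (HQ n La Ga),
     [/\ is_M Eps Sgn M_eps_sgn /\ is_M Sgn Eps M_sgn_eps,
         eps_sgn_type M_eps_sgn 1 1 /\ eps_sgn_type M_sgn_eps 1 1,
         ~ mod_iso M_eps_sgn M_sgn_eps
       & forall M : lmodType (HQ n La Ga), eps_sgn_type M 1 1 ->
           (indecomposable_mod M <->
              mod_iso M M_eps_sgn \/ mod_iso M M_sgn_eps)]).
Proof.
have n_ge2 : (2 <= n)%N := ltnW n_ge3.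
have natr_eq0 := (@pcharf0P k).1 k_char0.
(* Characteristic 0 enters through two integers: 2 separates the weights, and the factorial of [n]
   normalizes the average over the group. *)
have two_neq0 : (2%:R : k) != 0 by rewrite natr_eq0.
have fact_neq0 : (n`!%:R : k) != 0 by rewrite natr_eq0 -lt0n fact_gt0.
split=> [M p q tM|].
  split; first exact: (eps_sgn_simple two_neq0 n_ge2 tM).
  exact: (eps_sgn_indecomposable two_neq0 n_ge2 tM).
exists (ext_mod n La Ga Eps), (ext_mod n La Ga Sgn); split.
- split; first exact: (ext_mod_is_M La Ga two_neq0 n_ge2 Eps fact_neq0).
  exact: (ext_mod_is_M La Ga two_neq0 n_ge2 Sgn fact_neq0).
- by split; apply: (bigen_eps_sgn_type two_neq0 n_ge2); apply: ext_mod_bigen.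
- exact: (ext_mod_not_iso two_neq0 n_ge2).
- by move=> M; apply: (eps_sgn_indecomposable1 two_neq0 n_ge2).
Qed.
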